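(* For each $\mathbf v\in\mathbb N^I$, the algebra $\mathcal A(\mathbf v)$ carries a $\mathbb Z^I\times\mathbb Z$-grading (as a ring) in which, for all $\mathbf 0\le\mathbf m\le\mathbf v$ and all homogeneous $f\in\Lambda^{(1^{\mathbf m})}(\mathbf v)$, the element $\mathsf M_{\mathbf m}(f)$ is homogeneous of degree $\big(\mathbf m,\ \deg f+\tfrac12(\mathbf m,\mathbf m)\big)$. For all $\mathbf v,\mathbf v'\in\mathbb N^I$ with $\mathbf v\ge\mathbf v'$ there is a surjective homomorphism of $\mathbb Z^I\times\mathbb Z$-graded rings $$\Phi_{\mathbf v,\mathbf v'}:\mathcal A(\mathbf v)\twoheadrightarrow\mathcal A(\mathbf v')$$ which respects fundamental monopole operators, i.e. for all $\mathbf 0\le\mathbf m\le\mathbf v$ and $f\in\Lambda^{(1^{\mathbf m})}(\mathbf v)$ one has $\Phi_{\mathbf v,\mathbf v'}(\mathsf M_{\mathbf m}(f))=\mathsf M_{\mathbf m}(\widetilde f)$ if $\mathbf m\le\mathbf v'$, and $\Phi_{\mathbf v,\mathbf v'}(\mathsf M_{\mathbf m}(f))=0$ otherwise.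
   Context: Conventions. $\Bbbk$ is a commutative ring, $\mathbb N=\{0,1,2,\dots\}$, $[n]=\{1,\dots,n\}$. $Q=(I,E)$ is a finite quiver (edge loops and multiple edges allowed) with source and target maps $\mathsf s,\mathsf t:E\to I$; $a_{ij}$ is the number of edges from $i$ to $j$ and $c_{ij}=2\delta_{ij}-a_{ij}-a_{ji}$. On $\mathbb Z^I$, $\mathbf v'\le\mathbf v$ means $v'_i\le v_i$ for all $i$, and $(\mathbf v',\mathbf v)=\sum_{i,j}c_{ij}v'_iv_j$. $R=\Bbbk[\tfrac12\hbar,\theta_e:e\in E]$ is a polynomial ring in variables $\tfrac12\hbar,\theta_e$, with $\hbar=2\cdot\tfrac12\hbar$. Difference operators. For $\mathbf v=(v_i)\in\mathbb N^I$ let $\widetilde\Lambda(\mathbf v)=R[w_{i,r}:i\in I,r\in[v_i]]$, on which $S_{\mathbf v}=\prod_iS_{v_i}$ acts by permuting the $w_{i,r}$ for each $i$, and $\Lambda(\mathbf v)=\widetilde\Lambda(\mathbf v)^{S_{\mathbf v}}$. Let $\widetilde A(\mathbf v)$ be the $R$-algebra generated by $w_{i,r},u_{i,r}$ ($i\in I,r\in[v_i]$) with relations $u_{i,r}w_{j,s}=(w_{j,s}+\hbar\delta_{ij}\delta_{rs})u_{i,r}$, $[u_{i,r},u_{j,s}]=[w_{i,r},w_{j,s}]=0$, and $\widetilde A(\mathbf v)_{loc}$ its Ore localization at the multiplicative set generated by $w_{i,r}-w_{i,s}+n\hbar$ ($r\ne s$, $n\in\mathbb Z$). Quantized zastava.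 $\mathcal A(\mathbf v)$ is the Braverman–Finkelberg–Nakajima convolution algebra $H_\bullet^{(\mathbf G_{\mathcal O}\rtimes\mathbb C^\times)\times\mathbf F}(\mathcal R^+_{\mathbf G,\mathbf N},\Bbbk)$ for $\mathbf G=\prod_i\mathbf{GL}_{v_i}$, $\mathbf N=\bigoplus_{e}\mathrm{Hom}(\mathbb C^{v_{\mathsf s(e)}},\mathbb C^{v_{\mathsf t(e)}})$, $\mathbf F=\prod_{e\in E}\mathbb C^\times$ scaling the summands. By known results (GKLO embedding and generation by monopole operators) it is identified with the following subalgebra of $\widetilde A(\mathbf v)_{loc}^{S_{\mathbf v}}$, which may be taken as its definition. For $\mathbf 0\le\mathbf m\le\mathbf v$ let $\Lambda^{(1^{\mathbf m})}(\mathbf v)=\widetilde\Lambda(\mathbf v)^{S_{\mathbf m}\times S_{\mathbf v-\mathbf m}}$, where $S_{\mathbf m}\times S_{\mathbf v-\mathbf m}\subseteq S_{\mathbf v}$ is the subgroup preserving each $[m_i]\subseteq[v_i]$. For $f\in\Lambda^{(1^{\mathbf m})}(\mathbf v)$ the fundamental monopole operator (FMO) is $$\mathsf M_{\mathbf m}(f)=\sum_{\Gamma}f|_\Gamma\cdot\frac{\prod_{e\in E}\prod_{r\in\Gamma_{\mathsf s(e)},\,s\in[v_{\mathsf t(e)}]\setminus\Gamma_{\mathsf t(e)}}(w_{\mathsf t(e),s}-w_{\mathsf s(e),r}+\theta_e-\tfrac12\hbar)}{\prod_{i\in I}\prod_{r\in\Gamma_i,\,s\in[v_i]\setminus\Gamma_i}(w_{i,r}-w_{i,s})}\prod_{i\in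 I}\prod_{r\in\Gamma_i}u_{i,r},$$ the sum over tuples $\Gamma=(\Gamma_i)_{i\in I}$ with $\Gamma_i\subseteq[v_i]$, $\#\Gamma_i=m_i$, where $f|_\Gamma=\sigma(f)$ for any $\sigma\in S_{\mathbf v}$ with $\sigma_i([m_i])=\Gamma_i$. $\mathcal A(\mathbf v)$ is the subring generated by all $\mathsf M_{\mathbf m}(f)$; note $\mathsf M_{\mathbf 0}(f)=f$, so $\Lambda(\mathbf v)\subseteq\mathcal A(\mathbf v)$. Degrees and restriction. $\deg f$ denotes polynomial degree with $\tfrac12\hbar,\theta_e,w_{i,r}$ all of degree $1$. For $\mathbf v\ge\mathbf v'$, $f\mapsto\widetilde f$ is the $R$-algebra map $\widetilde\Lambda(\mathbf v)\to\widetilde\Lambda(\mathbf v')$ setting $w_{i,r}=0$ for $v'_i<r\le v_i$; for $\mathbf m\le\mathbf v'$ it maps $\Lambda^{(1^{\mathbf m})}(\mathbf v)$ onto $\Lambda^{(1^{\mathbf m})}(\mathbf v')$. *)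

(* Defs.v *)
From HB Require Import structures.
From mathcomp Require Import all_boot all_order all_fingroup all_algebra.
From mathcomp Require Import generic_quotient ring.
From mathcomp Require Import boolp.
From mathcomp Require Import ssrcomplements mpoly.

Set Implicit Arguments.
Unset Strict Implicit.
Unset Printing Implicit Defensive.

Import GRing.Theory.

Local Open Scope ring_scope.
Local Open Scope quotient_scope.

(* Keys for [locked_with], which keeps conversion from unfolding the sealed
   definitions; [locked_withE] unseals them. *)
Fact seal_add : unit. Proof. exact: tt. Qed.
Fact seal_opp : unit. Proof. exact: tt. Qed.
Fact seal_mul : unit. Proof. exact: tt. Qed.
Fact seal_inv : unit. Proof. exact: tt. Qed.
Fact seal_frac : unit. Proof. exact: tt. Qed.
Fact seal_lift : unit. Proof. exact: tt. Qed.
Fact seal_subst : unit. Proof. exact: tt. Qed.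
Fact seal_twist : unit. Proof. exact: tt. Qed.

(* Localization of the commutative ring P at the multiplicative set generated
   by a family [den] of regular elements (non-zero-divisors).  A representative
   is a numerator together with the list of the factors of its denominator. *)
Section Localization.

Context (P : comNzRingType) (D : choiceType) (den : D -> P).
Hypothesis den_reg : forall d, GRing.lreg (den d).

Definition denom (ds : seq D) : P := \prod_(d <- ds) den d.

Lemma denom_cat ds ds' : denom (ds ++ ds') = denom ds * denom ds'.
Proof. exact: big_cat. Qed.

Lemma denom_nil : denom [::] = 1. Proof. exact: big_nil. Qed.

Lemma denom_reg ds : GRing.lreg (denom ds).
Proof.
elim: ds => [|d ds IHds]; first by rewrite denom_nil; apply: lreg1.
by rewrite /denom big_cons; apply: lregM; [apply: den_reg | apply: IHds].
Qed.

Definition loc_eqv (x y : P * seq D) := x.1 * denom y.2 == y.1 * denom x.2.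

Lemma loc_eqv_refl : reflexive loc_eqv.
Proof. by move=> x; rewrite /loc_eqv. Qed.

Lemma loc_eqv_sym : ssrbool.symmetric loc_eqv.
Proof. by move=> x y; rewrite /loc_eqv eq_sym. Qed.

Lemma loc_eqv_trans : transitive loc_eqv.
Proof.
move=> y x z /eqP xy /eqP yz; apply/eqP/(@denom_reg y.2).
rewrite mulrA [denom y.2 * _]mulrC xy mulrAC yz; ring.
Qed.

Canonical loc_equiv := EquivRel loc_eqv loc_eqv_refl loc_eqv_sym loc_eqv_trans.

Definition loc := {eq_quot loc_eqv}.

HB.instance Definition _ : EqQuotient _ loc_eqv loc := EqQuotient.on loc.
HB.instance Definition _ := Choice.on loc.

Definition lfrac : P -> seq D -> loc :=
  locked_with seal_frac (fun n ds => \pi_loc (n, ds)).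

Lemma lfrac_eq n ds n' ds' :
  (lfrac n ds = lfrac n' ds') <-> (n * denom ds' = n' * denom ds).
Proof.
by rewrite /lfrac unlock; split => [/eqmodP/eqP|H]; last apply/eqmodP/eqP.
Qed.

Definition lnum (x : loc) := (repr x).1.
Definition lden (x : loc) := (repr x).2.

Lemma lfracK x : lfrac (lnum x) (lden x) = x.
Proof. by rewrite /lfrac unlock -surjective_pairing reprK. Qed.

Lemma lfrac_repr n ds :
  lnum (lfrac n ds) * denom ds = n * denom (lden (lfrac n ds)).
Proof. by apply/lfrac_eq; rewrite lfracK. Qed.

Lemma locW (T : loc -> Prop) : (forall n ds, T (lfrac n ds)) -> forall x, T x.
Proof. by move=> H x; rewrite -(lfracK x). Qed.

Definition loc_add : loc -> loc -> loc := locked_with seal_add (fun x y =>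
  lfrac (lnum x * denom (lden y) + lnum y * denom (lden x)) (lden x ++ lden y)).
Definition loc_opp : loc -> loc :=
  locked_with seal_opp (fun x => lfrac (- lnum x) (lden x)).
Definition loc_mul : loc -> loc -> loc := locked_with seal_mul (fun x y =>
  lfrac (lnum x * lnum y) (lden x ++ lden y)).

Local Notation add := loc_add.
Local Notation opp := loc_opp.
Local Notation mul := loc_mul.

Let addE n ds n' ds' : add (lfrac n ds) (lfrac n' ds') =
  lfrac (n * denom ds' + n' * denom ds) (ds ++ ds').
Proof.
rewrite /loc_add unlock; apply/lfrac_eq; rewrite !denom_cat.
have H := lfrac_repr n ds; have H' := lfrac_repr n' ds'.
set a := lnum _ in H *; set s := lden _ in H *.
set b := lnum _ in H' *; set t := lden _ in H' *.
transitivity ((a * denom ds) * denom t * denom ds' +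
              (b * denom ds') * denom s * denom ds); first by ring.
by rewrite H H'; ring.
Qed.

Let oppE n ds : opp (lfrac n ds) = lfrac (- n) ds.
Proof.
by rewrite /loc_opp unlock; apply/lfrac_eq; rewrite mulNr lfrac_repr mulNr.
Qed.

Let mulE n ds n' ds' :
  mul (lfrac n ds) (lfrac n' ds') = lfrac (n * n') (ds ++ ds').
Proof.
rewrite /loc_mul unlock; apply/lfrac_eq.
by rewrite !denom_cat mulrACA !lfrac_repr; ring.
Qed.

Let addA : associative add.
Proof.
elim/locW=> a s; elim/locW=> b t; elim/locW=> c u.
by rewrite !addE; apply/lfrac_eq; rewrite !denom_cat; ring.
Qed.

Let addC : commutative add.
Proof.
elim/locW=> a s; elim/locW=> b t.
by rewrite !addE; apply/lfrac_eq; rewrite !denom_cat; ring.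
Qed.

Let add0 : left_id (lfrac 0 [::]) add.
Proof.
elim/locW=> a s.
by rewrite !addE; apply/lfrac_eq; rewrite !denom_cat denom_nil; ring.
Qed.

Let addN : left_inverse (lfrac 0 [::]) opp add.
Proof.
elim/locW=> a s.
by rewrite oppE !addE; apply/lfrac_eq; rewrite !denom_cat denom_nil; ring.
Qed.

HB.instance Definition _ := GRing.isZmodule.Build loc addA addC add0 addN.

Let mulA : associative mul.
Proof.
elim/locW=> a s; elim/locW=> b t; elim/locW=> c u.
by rewrite !mulE; apply/lfrac_eq; rewrite !denom_cat; ring.
Qed.

Let mulC : commutative mul.
Proof.
elim/locW=> a s; elim/locW=> b t.
by rewrite !mulE; apply/lfrac_eq; rewrite !denom_cat; ring.
Qed.

Let mul1 : left_id (lfrac 1 [::]) mul.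
Proof.
elim/locW=> a s.
by rewrite !mulE; apply/lfrac_eq; rewrite !denom_cat denom_nil; ring.
Qed.

Let mulD : left_distributive mul add.
Proof.
elim/locW=> a s; elim/locW=> b t; elim/locW=> c u.
by rewrite addE !mulE addE; apply/lfrac_eq; rewrite !denom_cat; ring.
Qed.

Let nonzero1 : lfrac 1 [::] != lfrac 0 [::].
Proof.
by apply/eqP => /lfrac_eq/eqP; rewrite denom_nil mul0r mul1r oner_eq0.
Qed.

HB.instance Definition _ :=
  GRing.Zmodule_isComNzRing.Build loc mulA mulC mul1 mulD nonzero1.

(* Units are recognized classically. *)
Definition loc_unit : {pred loc} := [pred x | `[< exists y, y * x = 1 >]].
Definition loc_inv : loc -> loc := locked_with seal_inv (fun x =>
  if pselect (exists y, y * x = 1) is left H then projT1 (cid H) else x).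

Local Notation inv := loc_inv.

Let mulVx : {in loc_unit, left_inverse 1 inv *%R}.
Proof.
move=> x /asboolP Hx; rewrite /loc_inv unlock.
by case: pselect => // H; case: (cid H).
Qed.

Let unitPl (x y : loc) : y * x = 1 -> loc_unit x.
Proof. by move=> H; apply/asboolP; exists y. Qed.

Let inv_out : {in [predC loc_unit], inv =1 id}.
Proof.
by move=> x /asboolP Hx; rewrite /loc_inv unlock; case: pselect.
Qed.

HB.instance Definition _ :=
  GRing.ComNzRing_hasMulInverse.Build loc mulVx unitPl inv_out.

Definition toloc (p : P) : loc := lfrac p [::].

Lemma toloc_is_zmod_morphism : zmod_morphism toloc.
Proof.
move=> p q; rewrite -[RHS]/(add _ (opp _)) oppE addE.
by apply/lfrac_eq; rewrite !denom_cat denom_nil; ring.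
Qed.

Lemma toloc_is_monoid_morphism : monoid_morphism toloc.
Proof. by split=> // p q; rewrite -[RHS]/(mul _ _) mulE. Qed.

HB.instance Definition _ :=
  GRing.isZmodMorphism.Build P loc toloc toloc_is_zmod_morphism.
HB.instance Definition _ :=
  GRing.isMonoidMorphism.Build P loc toloc toloc_is_monoid_morphism.

Lemma toloc_inj : injective toloc.
Proof. by move=> p q /lfrac_eq; rewrite denom_nil !mulr1. Qed.

Lemma toloc_denom_unit ds : toloc (denom ds) \is a GRing.unit.
Proof.
apply/unitrPr; exists (lfrac 1 ds); rewrite -[LHS]/(mul _ _) mulE.
by apply/lfrac_eq; rewrite denom_nil; ring.
Qed.

Lemma toloc_den_unit d : toloc (den d) \is a GRing.unit.
Proof.
by move: (toloc_denom_unit [:: d]); rewrite /denom big_seq1.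
Qed.

Lemma lfracE n ds : lfrac n ds = toloc n / toloc (denom ds).
Proof.
apply: (mulIr (toloc_denom_unit ds)); rewrite divrK ?toloc_denom_unit //.
rewrite -[LHS]/(mul _ _) mulE cats0.
by apply/lfrac_eq; rewrite denom_nil mulr1.
Qed.

Section Lift.

Context (B : unitRingType) (f : {rmorphism P -> B}).
Hypothesis f_unit : forall d, f (den d) \is a GRing.unit.

Definition loc_lift : loc -> B :=
  locked_with seal_lift (fun x => f (lnum x) / f (denom (lden x))).

Lemma f_denom_unit ds : f (denom ds) \is a GRing.unit.
Proof.
elim: ds => [|d ds IHds]; first by rewrite denom_nil rmorph1 unitr1.
by rewrite /denom big_cons rmorphM unitrMl ?IHds ?f_unit.
Qed.

Lemma f_comm p q : GRing.comm (f p) (f q).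
Proof. by rewrite /GRing.comm -!rmorphM mulrC. Qed.

Lemma loc_lift_frac n ds : loc_lift (lfrac n ds) = f n / f (denom ds).
Proof.
rewrite /loc_lift unlock; set x := lfrac n ds; have := lfrac_repr n ds.
rewrite -/x => /(congr1 f); rewrite !rmorphM => H.
apply: (mulIr (f_denom_unit (lden x))); rewrite divrK ?f_denom_unit //.
apply: (mulIr (f_denom_unit ds)); rewrite H -!mulrA; congr (_ * _).
by rewrite (f_comm (denom (lden x))) mulKr ?f_denom_unit.
Qed.

Lemma loc_liftE p : loc_lift (toloc p) = f p.
Proof. by rewrite loc_lift_frac denom_nil rmorph1 divr1. Qed.

Lemma loc_liftK n ds : loc_lift (lfrac n ds) * f (denom ds) = f n.
Proof. by rewrite loc_lift_frac divrK ?f_denom_unit. Qed.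

Lemma loc_lift_is_zmod_morphism : zmod_morphism loc_lift.
Proof.
elim/locW=> a s; elim/locW=> b t.
have -> : lfrac a s - lfrac b t = lfrac (a * denom t - b * denom s) (s ++ t).
  by rewrite -[LHS]/(add _ (opp _)) oppE addE mulNr.
apply: (mulIr (f_denom_unit (s ++ t))); rewrite loc_liftK mulrBl denom_cat.
rewrite {2}[denom s * _]mulrC rmorphB !rmorphM !mulrA.
by rewrite !loc_liftK.
Qed.

Lemma loc_lift_is_monoid_morphism : monoid_morphism loc_lift.
Proof.
split; first by rewrite -[1]/(toloc 1) loc_liftE rmorph1.
elim/locW=> a s; elim/locW=> b t.
rewrite -[_ * lfrac _ _]/(mul _ _) mulE.
apply: (mulIr (f_denom_unit (s ++ t))); rewrite loc_liftK denom_cat.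
rewrite [denom s * _]mulrC !rmorphM [RHS]mulrA -[X in X * f (denom s)]mulrA.
by rewrite loc_liftK -mulrA (f_comm b) mulrA loc_liftK.
Qed.

End Lift.

(* The hypothesis on [f] is an argument, so that [loc_liftr] is a morphism. *)
Definition loc_liftr (B : unitRingType) (f : {rmorphism P -> B})
  (fU : forall d, f (den d) \is a GRing.unit) : loc -> B := loc_lift f.

HB.instance Definition _ (B : unitRingType) (f : {rmorphism P -> B}) fU :=
  GRing.isZmodMorphism.Build loc B
  (@loc_liftr B f fU) (loc_lift_is_zmod_morphism fU).
HB.instance Definition _ (B : unitRingType) (f : {rmorphism P -> B}) fU :=
  GRing.isMonoidMorphism.Build loc B
  (@loc_liftr B f fU) (loc_lift_is_monoid_morphism fU).

Lemma loc_rmorph_ext (B : nzRingType) (g h : {rmorphism loc -> B}) :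
  (forall p, g (toloc p) = h (toloc p)) -> g =1 h.
Proof.
move=> gh; elim/locW=> a s; rewrite lfracE; set d := toloc (denom s).
have Ud : d \is a GRing.unit by apply: toloc_denom_unit.
rewrite !rmorphM gh; congr (_ * _).
rewrite -[LHS]mulr1 -(rmorph1 h) -(divrr Ud) rmorphM mulrA.
by rewrite -gh -rmorphM mulVr // rmorph1 mul1r.
Qed.

End Localization.

Lemma mpoly_rmorph_ext (k : nzRingType) (n : nat) (B : nzRingType)
    (g h : {rmorphism {mpoly k[n]} -> B}) :
  (forall c, g c%:MP = h c%:MP) -> (forall i, g 'X_i = h 'X_i) -> g =1 h.
Proof.
move=> ghC ghX p; rewrite [p]mpolyE !rmorph_sum; apply: eq_bigr => m _.
rewrite -mul_mpolyC !rmorphM ghC; congr (_ * _).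
rewrite mpolyXE_id !rmorph_prod; apply: eq_bigr => i _.
by rewrite !rmorphXn ghX.
Qed.

Lemma mpoly_lin_ind (R : nzRingType) (n : nat) (T : {mpoly R[n]} -> Prop) :
  T 0 -> (forall p q, T p -> T q -> T (p + q)) ->
  (forall c m, T (c *: 'X_[m])) -> forall p, T p.
Proof.
by move=> T0 TD TX p; rewrite [p]mpolyE; apply: big_ind => // m _; apply: TX.
Qed.

Section Polynomials.

Context (k : comNzRingType) (I E : finType).

(* [wvar v] indexes the pairs (i, r) with i in I and r in [v_i] (0-based),
   [var v] all the variables, [inl None] standing for hbar/2, [inl (Some e)]
   for theta_e and [inr (i, r)] for w_(i,r). *)
Definition wvar (v : {ffun I -> nat}) : finType := {i : I & 'I_(v i)}.
Definition var (v : {ffun I -> nat}) : finType := (option E + wvar v)%type.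

(* The polynomial ring R[w_(i,r)], with R = k[hbar/2, theta_e]. *)
Local Notation tLam v := {mpoly k[#|var v|]}.

Section OneDim.

Context {v : {ffun I -> nat}}.

Definition vX (x : var v) : tLam v := 'X_(enum_rank x).
Definition hhbar : tLam v := vX (inl None).
Definition hbar : tLam v := hhbar *+ 2.
Definition theta (e : E) : tLam v := vX (inl (Some e)).
Definition w (x : wvar v) : tLam v := vX (inr x).

End OneDim.

Lemma tLam_rmorph_ext v (B : nzRingType) (g h : {rmorphism tLam v -> B}) :
  (forall c : k, g c%:MP = h c%:MP) -> (forall x, g (vX x) = h (vX x)) ->
  g =1 h.
Proof.
by move=> gC gX; apply: mpoly_rmorph_ext => // i; have := gX (enum_val i);
  rewrite /vX enum_valK.
Qed.

(* The k[hbar/2, theta]-algebra map sending w_x to h x. *)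
Definition wsubst_var {v v'} (h : wvar v -> tLam v') (x : var v) : tLam v' :=
  match x with inl c => vX (inl c) | inr y => h y end.

Definition wsubst {v v'} : (wvar v -> tLam v') -> tLam v -> tLam v' :=
  locked_with seal_subst
    (fun h => mmap (@mpolyC #|var v'| k) (fun i => wsubst_var h (enum_val i))).

Section WsubstMorphism.

Context {v v' : {ffun I -> nat}} (h : wvar v -> tLam v').

Lemma wsubst_is_zmod_morphism : zmod_morphism (wsubst h).
Proof. by rewrite /wsubst locked_withE; apply: raddfB. Qed.

Lemma wsubst_is_monoid_morphism : monoid_morphism (wsubst h).
Proof.
by rewrite /wsubst locked_withE; split=> [|p q]; [apply: rmorph1 | apply: rmorphM].
Qed.

HB.instance Definition _ := GRing.isZmodMorphism.Build (tLam v) (tLam v')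
  (wsubst h) wsubst_is_zmod_morphism.
HB.instance Definition _ := GRing.isMonoidMorphism.Build (tLam v) (tLam v')
  (wsubst h) wsubst_is_monoid_morphism.

Lemma wsubst_vX x : wsubst h (vX x) = wsubst_var h x.
Proof. by rewrite /wsubst locked_withE mmapX mmap1U enum_rankK. Qed.

Lemma wsubst_w x : wsubst h (w x) = h x.
Proof. exact: wsubst_vX. Qed.

Lemma wsubst_l c : wsubst h (vX (inl c)) = vX (inl c).
Proof. exact: wsubst_vX. Qed.

Lemma wsubst_C c : wsubst h c%:MP = c%:MP.
Proof. by rewrite /wsubst locked_withE mmapC. Qed.

End WsubstMorphism.

Lemma wsubst_hbar v v' (h : wvar v -> tLam v') : wsubst h hbar = hbar.
Proof. by rewrite /hbar /hhbar rmorphMn /= wsubst_l. Qed.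

Lemma wsubst_ext v (B : nzRingType) (g h : {rmorphism tLam v -> B}) :
  (forall c : k, g c%:MP = h c%:MP) -> (forall c, g (vX (inl c)) = h (vX (inl c))) ->
  (forall x, g (w x) = h (w x)) -> g =1 h.
Proof. by move=> gC gl gw; apply: tLam_rmorph_ext => // -[]. Qed.

Lemma wsubst_comp v v' v'' (h : wvar v -> tLam v') (g : wvar v' -> tLam v'') p :
  wsubst g (wsubst h p) = wsubst (fun x => wsubst g (h x)) p.
Proof.
move: p; apply: (@wsubst_ext _ _ (wsubst g \o wsubst h)) => [c|c|x].
- by rewrite /= !wsubst_C.
- by rewrite /= !wsubst_l.
- by rewrite /= !wsubst_w.
Qed.

Lemma wsubst_id v p : wsubst (@w v) p = p.
Proof.
move: p; apply: (@wsubst_ext _ _ (wsubst (@w v)) idfun) => [c|c|x].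
- exact: wsubst_C.
- exact: wsubst_l.
- exact: wsubst_w.
Qed.

Lemma eq_wsubst v v' (h g : wvar v -> tLam v') : h =1 g -> wsubst h =1 wsubst g.
Proof.
move=> hg; apply: wsubst_ext => [c|c|x].
- by rewrite /= !wsubst_C.
- by rewrite /= !wsubst_l.
- by rewrite /= !wsubst_w.
Qed.

(* The generators w_(i,r) - w_(i,s) + n hbar of the denominator set. *)
Definition dfactor v : choiceType :=
  {d : wvar v * wvar v * int | (tag d.1.1 == tag d.1.2) && (d.1.1 != d.1.2)}.

Definition dpoly v (d : dfactor v) : tLam v :=
  w (val d).1.1 - w (val d).1.2 + hbar *~ (val d).2.

Lemma vX_reg v (x : var v) : GRing.lreg (vX x).
Proof.
move=> p q /= /mpolyP pq; apply/mpolyP => m; have := pq (U_(enum_rank x) + m)%MM.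
by rewrite ![vX x * _]mulrC !mcoeffMX.
Qed.

Lemma dpoly_reg v (d : dfactor v) : GRing.lreg (dpoly d).
Proof.
case: d => -[[x y] n]; rewrite /dpoly /= => /andP[_ /= nxy].
pose c : tLam v := - w y + hbar *~ n.
pose a z := if z == x then w x - c else w z.
pose b z := if z == x then w x + c else w z.
have ac : wsubst a c = c.
  rewrite rmorphD rmorphN rmorphMz /= wsubst_hbar wsubst_w /a.
  by rewrite eq_sym (negPf nxy).
have bc : wsubst b c = c.
  rewrite rmorphD rmorphN rmorphMz /= wsubst_hbar wsubst_w /b.
  by rewrite eq_sym (negPf nxy).
have abK : cancel (wsubst a) (wsubst b).
  move=> p; rewrite wsubst_comp -[RHS]wsubst_id; apply: eq_wsubst => z.
  rewrite {1}/a; case: eqP => [->|/eqP nz].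
    by rewrite rmorphB /= bc wsubst_w /b eqxx addrK.
  by rewrite wsubst_w /b (negPf nz).
move=> p q pq; apply: (can_inj abK); apply: (@vX_reg _ (inr x)).
suff -> : vX (inr x) = wsubst a (w x - w y + hbar *~ n).
  by rewrite -!rmorphM pq.
by rewrite -addrA rmorphD /= ac wsubst_w /a eqxx subrK.
Qed.

Local Notation tLamloc v := (loc (@dpoly_reg v)).
Local Notation inloc v := (toloc (@dpoly_reg v)).

(* Conjugation by the monomial u^a:  u^a p = shift a p u^a. *)
Definition shift v (a : 'X_{1..#|wvar v|}) : tLam v -> tLam v :=
  wsubst (fun x => w x + hbar *+ a (enum_rank x)).

HB.instance Definition _ v a := GRing.RMorphism.on (@shift v a).

Lemma shift_w v a x : shift a (@w v x) = w x + hbar *+ a (enum_rank x).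
Proof. exact: wsubst_w. Qed.

Lemma shift_hbar v a : shift a (@hbar v) = hbar.
Proof. exact: wsubst_hbar. Qed.

Lemma shift_C v a c : shift a (c%:MP : tLam v) = c%:MP.
Proof. exact: wsubst_C. Qed.

Lemma shift_l v a c : shift a (vX (inl c) : tLam v) = vX (inl c).
Proof. exact: wsubst_l. Qed.

Lemma shiftD v a b (p : tLam v) : shift (a + b)%MM p = shift a (shift b p).
Proof.
rewrite [RHS]wsubst_comp; apply: eq_wsubst => x.
by rewrite rmorphD rmorphMn /= wsubst_w wsubst_hbar mnmDE mulrnDr addrA.
Qed.

Lemma shift0 v (p : tLam v) : shift 0%MM p = p.
Proof.
rewrite -[RHS]wsubst_id; apply: eq_wsubst => x.
by rewrite mnm0E mulr0n addr0.
Qed.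

Lemma shift_den_unit v a (d : dfactor v) :
  (inloc v \o shift a) (dpoly d) \is a GRing.unit.
Proof.
case: d => -[[x y] n] /= H.
pose n1 : int := (n + (a (enum_rank x))%:Z - (a (enum_rank y))%:Z)%R.
pose d' : dfactor v := exist _ (x, y, n1) H.
suff -> : shift a (dpoly (exist _ (x, y, n) H)) = dpoly d'.
  exact: toloc_den_unit.
rewrite /dpoly /n1 /= rmorphD rmorphB rmorphMz /= shift_hbar !shift_w.
rewrite !mulrzDr mulrNz -!pmulrn; ring.
Qed.

Definition lshift v a : tLamloc v -> tLamloc v :=
  loc_liftr (@shift_den_unit v a).

HB.instance Definition _ v a := GRing.RMorphism.on (@lshift v a).

Lemma lshiftE v a p : lshift a (inloc v p) = inloc v (shift a p).
Proof. exact: (@loc_liftE _ _ _ (@dpoly_reg v) _ _ (@shift_den_unit v a)). Qed.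

Lemma lshiftD v a b (x : tLamloc v) :
  lshift (a + b)%MM x = lshift a (lshift b x).
Proof.
move: x; apply: (@loc_rmorph_ext _ _ _ _ _ (lshift _) (lshift a \o lshift b)).
by move=> p; rewrite /= !lshiftE shiftD.
Qed.

Lemma lshift0 v (x : tLamloc v) : lshift 0%MM x = x.
Proof.
move: x; apply: (@loc_rmorph_ext _ _ _ _ _ (lshift _) idfun).
by move=> p; rewrite /= lshiftE shift0.
Qed.

(* The Ore localization of the ring of difference operators, as the left module
   over the localization of [tLam v] with basis the monomials u^a, a in
   N^(wvar v).  The underlying module is borrowed from the polynomial ring in
   the u_x, and the product is the one twisted by [lshift], so that
   u^a p = lshift a p u^a.  [tAloc_universal] and [tAloc_universal_unique] below
   show that this is the ring given by generators and relations, localized. *)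
Definition tAloc v := {mpoly (tLamloc v)[#|wvar v|]}.

Section Twisted.

Context (v : {ffun I -> nat}).

HB.instance Definition _ := GRing.Lmodule.on (tAloc v).

Local Notation poly := {mpoly (tLamloc v)[#|wvar v|]}.

Definition tAmul : tAloc v -> tAloc v -> tAloc v :=
  locked_with seal_twist (fun f g : poly =>
    \sum_(a <- msupp f) f@_a *: ('X_[a] * map_mpoly (lshift a) g)).

Lemma tAmul_w n (f g : poly) : (msize f <= n)%N ->
  tAmul f g = \sum_(a : 'X_{1..#|wvar v| < n})
    f@_a *: ('X_[a] * map_mpoly (lshift a) g).
Proof.
move=> fn; pose F (a : 'X_{1..#|wvar v|}) := f@_a *: ('X_[a] * map_mpoly (lshift a) g).
rewrite /tAmul locked_withE (big_mksub 'X_{1..#|wvar v| < n}) /=; first last.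
- by move=> x /msize_mdeg_lt/leq_trans; apply.
- by rewrite msupp_uniq.
rewrite big_rmcond //= => i; move/memN_msupp_eq0 ->; exact: scale0r.
Qed.

Lemma tAmulDl : left_distributive tAmul +%R.
Proof.
move=> f g h; pose n := maxn (maxn (msize f) (msize g)) (msize (f + g)).
rewrite !(@tAmul_w n) ?leq_max ?leqnn ?orbT // -big_split /=.
by apply: eq_bigr => a _; rewrite mcoeffD scalerDl.
Qed.

Lemma tAmulDr : right_distributive tAmul +%R.
Proof.
move=> f g h; rewrite /tAmul locked_withE -big_split /=; apply: eq_bigr => a _.
have -> : map_mpoly (lshift a) (g + h) =
  map_mpoly (lshift a) g + map_mpoly (lshift a) h by exact: raddfD.
by rewrite mulrDr scalerDr.
Qed.

Lemma tAmul0l g : tAmul 0 g = 0.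
Proof. by rewrite /tAmul locked_withE msupp0 big_nil. Qed.

Lemma tAmul0r f : tAmul f 0 = 0.
Proof. by rewrite /tAmul locked_withE big1 // => a _; rewrite raddf0 mulr0 scaler0. Qed.

Lemma tAmulZX c a g :
  tAmul (c *: 'X_[a] : poly) g = c *: ('X_[a] * map_mpoly (lshift a) g).
Proof.
rewrite (@tAmul_w (mdeg a).+1); last by rewrite (leq_trans (msizeZ_le _ _)) ?msizeX.
rewrite (bigD1 (BMultinom (leqnn (mdeg a).+1))) //= big1 => [|b nb].
  by rewrite mcoeffZ mcoeffX eqxx mulr1 addr0.
rewrite mcoeffZ mcoeffX (_ : (a == bmnm b) = false) ?mulr0 ?scale0r //.
by apply: contraNF nb => /eqP ab; apply/eqP/val_inj.
Qed.

Lemma tAmulZXZX c a d b :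
  tAmul (c *: 'X_[a] : poly) (d *: 'X_[b] : poly) = (c * lshift a d) *: 'X_[a + b].
Proof.
by rewrite tAmulZX map_mpolyZ map_mpolyX -scalerAr scalerA mpolyXD.
Qed.

Lemma tAmulA : associative tAmul.
Proof.
move=> f g h; move: f; apply: mpoly_lin_ind => [|p q IHp IHq|c a].
- by rewrite !tAmul0l.
- by rewrite !tAmulDl IHp IHq.
move: g; apply: mpoly_lin_ind => [|p q IHp IHq|d b].
- by rewrite tAmul0r !tAmul0l tAmul0r.
- by rewrite tAmulDl !tAmulDr tAmulDl IHp IHq.
move: h; apply: mpoly_lin_ind => [|p q IHp IHq|e m].
- by rewrite !tAmul0r.
- by rewrite !tAmulDr IHp IHq.
by rewrite !tAmulZXZX lshiftD rmorphM mulrA addmA.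
Qed.

Lemma tAmul1l : left_id (1 : poly) tAmul.
Proof.
move=> g; rewrite -[1 : poly]scale1r -mpolyX0 tAmulZX mpolyX0 mul1r scale1r.
move: g; apply: mpoly_lin_ind => [|p q IHp IHq|c a].
- exact: raddf0.
- by rewrite raddfD /= IHp IHq.
- by rewrite map_mpolyZ map_mpolyX /= lshift0.
Qed.

Lemma tAmul1r : right_id (1 : poly) tAmul.
Proof.
apply: mpoly_lin_ind => [|p q IHp IHq|c a].
- exact: tAmul0l.
- by rewrite tAmulDl IHp IHq.
- by rewrite tAmulZX rmorph1 mulr1.
Qed.

HB.instance Definition _ := GRing.Zmodule_isNzRing.Build (tAloc v)
  tAmulA tAmul1l tAmul1r tAmulDl tAmulDr (oner_neq0 poly).

End Twisted.

Section TheoryTAloc.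

Context {v : {ffun I -> nat}}.

Local Notation poly := {mpoly (tLamloc v)[#|wvar v|]}.

Definition cst (c : tLamloc v) : tAloc v := (c%:MP : poly).
Definition umon (a : 'X_{1..#|wvar v|}) : tAloc v := ('X_[a] : poly).
Definition u (x : wvar v) : tAloc v := umon U_(enum_rank x).

Let cstE c : cst c = c *: ('X_[0%MM] : poly).
Proof. by rewrite mpolyX0 -mul_mpolyC mulr1. Qed.

Let umonE a : umon a = 1 *: ('X_[a] : poly).
Proof. by rewrite scale1r. Qed.

Lemma cst_is_zmod_morphism : zmod_morphism cst.
Proof. exact: (raddfB (@mpolyC #|wvar v| (tLamloc v))). Qed.

Lemma cst_is_monoid_morphism : monoid_morphism cst.
Proof.
by split=> // c d; rewrite !cstE [RHS]tAmulZXZX lshift0 addm0.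
Qed.

HB.instance Definition _ := GRing.isZmodMorphism.Build (tLamloc v) (tAloc v)
  cst cst_is_zmod_morphism.
HB.instance Definition _ := GRing.isMonoidMorphism.Build (tLamloc v) (tAloc v)
  cst cst_is_monoid_morphism.

Lemma cst_inj : injective cst.
Proof. exact: can_inj (@mpolyCK _ _). Qed.

Lemma cst_umon c a : cst c * umon a = (c *: 'X_[a] : poly).
Proof. by rewrite cstE umonE [LHS]tAmulZXZX rmorph1 mulr1 add0m. Qed.

(* tAloc is a free left module over tLamloc with basis the umon a. *)
Lemma tAloc_basis (f : tAloc v) :
  f = \sum_(a <- msupp (f : poly)) cst (f : poly)@_a * umon a.
Proof. by under eq_bigr do rewrite cst_umon; exact: mpolyE. Qed.

Lemma tAloc_ind (T : tAloc v -> Prop) :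
  T 0 -> (forall f g, T f -> T g -> T (f + g)) ->
  (forall c a, T (cst c * umon a)) -> forall f, T f.
Proof.
move=> T0 TD TX; apply: mpoly_lin_ind => // c a.
by rewrite -cst_umon.
Qed.

Lemma umonD a b : umon (a + b)%MM = umon a * umon b.
Proof.
by rewrite [umon a]umonE [umon b]umonE [RHS]tAmulZXZX rmorph1 mulr1 umonE.
Qed.

Lemma umon0 : umon 0%MM = 1.
Proof. exact: mpolyX0. Qed.

Lemma umon_cst a c : umon a * cst c = cst (lshift a c) * umon a.
Proof. by rewrite cst_umon umonE cstE [LHS]tAmulZXZX mul1r addm0. Qed.

Lemma u_comm x y : u x * u y = u y * u x.
Proof. by rewrite -!umonD addmC. Qed.

Lemma u_w x y : u x * cst (inloc v (w y)) =
  cst (inloc v (w y + hbar *+ (x == y))) * u x.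
Proof. by rewrite umon_cst lshiftE shift_w mnm1E (inj_eq enum_rank_inj). Qed.

Lemma u_coef x (c : k) :
  u x * cst (inloc v c%:MP) = cst (inloc v c%:MP) * u x.
Proof. by rewrite umon_cst lshiftE shift_C. Qed.

Lemma u_param x c :
  u x * cst (inloc v (vX (inl c))) = cst (inloc v (vX (inl c))) * u x.
Proof. by rewrite umon_cst lshiftE shift_l. Qed.

Lemma dpoly_inv (d : dfactor v) : exists z : tAloc v,
  z * cst (inloc v (dpoly d)) = 1 /\ cst (inloc v (dpoly d)) * z = 1.
Proof.
have dU : inloc v (dpoly d) \is a GRing.unit := toloc_den_unit _ d.
exists (cst (inloc v (dpoly d))^-1).
by rewrite -!rmorphM mulVr // mulrV // rmorph1.
Qed.

Lemma umon_prod a : umon a = \prod_i u (enum_val i) ^+ a i.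
Proof.
rewrite {1}[a]multinomUE_id.
elim: (index_enum _) => [|i r IHr]; first by rewrite !big_nil umon0.
rewrite !big_cons umonD IHr; congr (_ * _).
rewrite /u enum_valK; elim: (a i) => [|n IHn].
  by rewrite expr0 mulm0n umon0.
by rewrite mulmS umonD IHn exprS.
Qed.

End TheoryTAloc.

(* Universal property: tAloc v is the ring presented by the generators and
   relations of the difference operators, with the elements w_x - w_y + n hbar
   (for x <> y over the same vertex) inverted. *)
Section Universal.

Context {v : {ffun I -> nat}} (B : unitRingType).
Context (phi : {rmorphism tLam v -> B}) (U : wvar v -> B).
Hypothesis phi_coef : forall x (c : k), GRing.comm (U x) (phi c%:MP).
Hypothesis phi_param : forall x c, GRing.comm (U x) (phi (vX (inl c))).
Hypothesis phi_w : forall x y,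
  U x * phi (w y) = phi (w y + hbar *+ (x == y)) * U x.
Hypothesis U_comm : forall x y, GRing.comm (U x) (U y).
Hypothesis phi_unit : forall d : dfactor v, phi (dpoly d) \is a GRing.unit.

Let Phi : {rmorphism tLamloc v -> B} := loc_liftr phi_unit.
Let V (a : 'X_{1..#|wvar v|}) := \prod_i U (enum_val i) ^+ a i.

Let V0 : V 0%MM = 1.
Proof. by rewrite /V big1 // => i _; rewrite mnm0E expr0. Qed.

Let VD a b : V (a + b)%MM = V a * V b.
Proof.
rewrite /V -prodrM_comm => [|i j _ _]; last first.
  exact/commrX/commr_sym/commrX/U_comm.
by apply: eq_bigr => i _; rewrite mnmDE exprD.
Qed.

Let VU x : V U_(enum_rank x) = U x.
Proof.
transitivity (\prod_(i | i == enum_rank x) U (enum_val i)); last first.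
  by rewrite big_pred1_eq enum_rankK.
rewrite [RHS]big_mkcond; apply: eq_bigr => i _.
by rewrite mnm1E eq_sym; case: eqP.
Qed.

Let U_shift x p : U x * phi p = phi (shift U_(enum_rank x) p) * U x.
Proof.
pose T (q : tLam v) := U x * phi q = phi (shift U_(enum_rank x) q) * U x.
have TD q r : T q -> T r -> T (q + r).
  by rewrite /T !rmorphD /= ?rmorphD mulrDr mulrDl => -> ->.
have TM q r : T q -> T r -> T (q * r).
  rewrite /T !rmorphM /= ?rmorphM => Tq Tr.
  by rewrite mulrA Tq -mulrA Tr mulrA.
have TC c : T c%:MP by rewrite /T /= shift_C; apply: phi_coef.
have TX y : T (vX y).
  case: y => y; first by rewrite /T /= shift_l; apply: phi_param.
  by rewrite /T /= shift_w phi_w mnm1E (inj_eq enum_rank_inj).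
rewrite -/(T p); move: p; apply: mpoly_lin_ind => [||c m].
- by rewrite -mpolyC0; apply: (TC).
- exact: TD.
rewrite -mul_mpolyC; apply: (TM); first exact: TC.
rewrite mpolyXE_id; apply: big_ind => [|q r|i _]; first 1 last.
- exact: TM.
- rewrite -[i]enum_valK -/(vX _); elim: (m _) => [|n IHn].
    by rewrite expr0 -mpolyC1; apply: (TC).
  by rewrite exprS; apply: (TM).
by rewrite -mpolyC1; apply: (TC).
Qed.

Let V_shift a p : V a * phi p = phi (shift a p) * V a.
Proof.
move: p; pose T b := forall p, V b * phi p = phi (shift b p) * V b.
have T0 : T 0%MM by move=> p; rewrite V0 shift0 mul1r mulr1.
have TD b c : T b -> T c -> T (b + c)%MM.
  by move=> Tb Tc p; rewrite VD -mulrA Tc mulrA Tb -mulrA shiftD.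
rewrite -/(T a) [a]multinomUE_id; apply: big_ind => // i _.
rewrite -[i]enum_valK; elim: (a _) => [|n IHn]; first by rewrite mulm0n.
by rewrite mulmS; apply: (TD) => // p; rewrite VU U_shift.
Qed.

Let PhiE p : Phi (inloc v p) = phi p.
Proof. exact: loc_liftE. Qed.

Let V_lshift a c : V a * Phi c = Phi (lshift a c) * V a.
Proof.
move: c; apply: locW => n ds; rewrite lfracE.
set d := inloc v (denom _ ds).
have dU : d \is a GRing.unit by apply: toloc_denom_unit.
apply: (mulIr (rmorph_unit Phi dU)).
rewrite -mulrA -rmorphM divrK // -[RHS]mulrA !PhiE !V_shift mulrA.
by rewrite -!PhiE -!lshiftE -!rmorphM /= divrK.
Qed.

Definition tAloc_lift (f : tAloc v) : B := mmap Phi (U \o enum_val) f.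

Let liftE c a : tAloc_lift (cst c * umon a) = Phi c * V a.
Proof. by rewrite cst_umon /tAloc_lift mmapZ mmapX. Qed.

Lemma tAloc_lift_is_zmod_morphism : zmod_morphism tAloc_lift.
Proof. exact: (raddfB (mmap Phi (U \o enum_val))). Qed.

HB.instance Definition _ := GRing.isZmodMorphism.Build (tAloc v) B
  tAloc_lift tAloc_lift_is_zmod_morphism.

Lemma tAloc_lift_is_monoid_morphism : monoid_morphism tAloc_lift.
Proof.
split=> [|f g].
  by rewrite -[1 in LHS]mulr1 -[X in X * _](rmorph1 cst) -umon0 liftE V0 mulr1 rmorph1.
move: f; apply: tAloc_ind => [|f f' IHf IHf'|c a].
- by rewrite mul0r raddf0 mul0r.
- by rewrite mulrDl raddfD [X in _ = X * _]raddfD mulrDl /= IHf IHf'.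
move: g; apply: tAloc_ind => [|g g' IHg IHg'|d b].
- by rewrite mulr0 raddf0 mulr0.
- by rewrite mulrDr raddfD [X in _ = _ * X]raddfD mulrDr /= IHg IHg'.
rewrite -mulrA [umon a * _]mulrA umon_cst -!mulrA -umonD mulrA -rmorphM !liftE.
by rewrite rmorphM VD -!mulrA [in RHS](mulrA (V a)) V_lshift !mulrA.
Qed.

HB.instance Definition _ := GRing.isMonoidMorphism.Build (tAloc v) B
  tAloc_lift tAloc_lift_is_monoid_morphism.

Theorem tAloc_universal : exists F : {rmorphism tAloc v -> B},
  (forall p, F (cst (inloc v p)) = phi p) /\ (forall x, F (u x) = U x).
Proof.
exists tAloc_lift; split=> [p|x] /=.
- by rewrite -[cst _]mulr1 -umon0 liftE V0 mulr1 PhiE.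
- by rewrite -[u x]mul1r -(rmorph1 cst) liftE rmorph1 mul1r VU.
Qed.

End Universal.

Theorem tAloc_universal_unique v (B : nzRingType) (F G : {rmorphism tAloc v -> B}) :
  (forall p, F (cst (inloc v p)) = G (cst (inloc v p))) ->
  (forall x, F (u x) = G (u x)) -> F =1 G.
Proof.
move=> FGc FGu; apply: tAloc_ind => [|f g IHf IHg|c a].
- by rewrite !raddf0.
- by rewrite !raddfD /= IHf IHg.
rewrite !rmorphM; congr (_ * _).
  exact: (loc_rmorph_ext (g := F \o cst) (h := G \o cst)).
rewrite umon_prod !rmorph_prod; apply: eq_bigr => i _.
by rewrite !rmorphXn /= FGu.
Qed.

End Polynomials.

Arguments vX {k I E v} x.
Arguments hhbar {k I E v}.
Arguments hbar {k I E v}.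
Arguments theta {k I E v} e.
Arguments w {k I E v} x.
Arguments tAloc k {I} E v.
Arguments u {k I E v} x.

Notation tLam k E v := {mpoly k[#|var E v|]}.
Notation inloc v := (toloc (@dpoly_reg _ _ _ v)).

Section Symmetric.

Context (k : comNzRingType) (I E : finType).

Definition windex (v : {ffun I -> nat}) (i : I) (r : 'I_(v i)) : wvar v :=
  Tagged (fun i => 'I_(v i)) r.

Definition wpos (v : {ffun I -> nat}) (x : wvar v) : 'I_(v (tag x)) := tagged x.

Definition leqv (v' v : {ffun I -> nat}) := [forall i, (v' i <= v i)%N].

(* S_v, as the group of permutations of [wvar v] preserving the vertex. *)
Definition Sv (v : {ffun I -> nat}) : {set {perm wvar v}} :=
  [set sg : {perm wvar v} | [forall x, tag (sg x) == tag x]].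

Definition sym_act (v : {ffun I -> nat}) (sg : {perm wvar v}) : tLam k E v -> tLam k E v :=
  wsubst (fun x => w (sg x)).

(* The union over i of the subsets [m_i] of [v_i]. *)
Definition initial (v m : {ffun I -> nat}) : {set wvar v} :=
  [set x | (wpos x < m (tag x))%N].

(* The invariants of S_m x S_(v-m); the subgroup is the stabilizer of the
   subset [initial v m]. *)
Definition Lam (v m : {ffun I -> nat}) : {pred tLam k E v} :=
  [pred f | [forall sg in Sv v,
     (sg @: initial v m == initial v m) ==> (sym_act sg f == f)]].

Arguments Lam : clear implicits.

(* Tuples (Gamma_i) with #Gamma_i = m_i, as subsets of [wvar v]. *)
Definition has_dim (v m : {ffun I -> nat}) (G : {set wvar v}) :=
  [forall i, #|[set x in G | tag x == i]| == m i].

(* f|_Gamma; see [at_subsetE] for the independence from the choice of the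
   permutation and [Sv_transitive] for its existence. *)
Definition at_subset (v m : {ffun I -> nat}) (f : tLam k E v) (G : {set wvar v}) : tLam k E v :=
  sym_act (odflt 1%g [pick sg in Sv v | sg @: initial v m == G]) f.

(* Sets w_(i,r) = 0 for v'_i < r <= v_i. *)
Definition restrict (v v' : {ffun I -> nat}) : tLam k E v -> tLam k E v' :=
  wsubst (fun x : wvar v =>
    if insub (val (wpos x)) is Some r
    then w (windex (r : 'I_(v' (tag x)))) else 0).

Lemma sym_actM (v : {ffun I -> nat}) (sg tau : {perm wvar v}) f :
  sym_act (sg * tau) f = sym_act tau (sym_act sg f).
Proof.
rewrite /sym_act wsubst_comp; apply: eq_wsubst => x.
by rewrite wsubst_w permM.
Qed.

Lemma Sv_group_set (v : {ffun I -> nat}) : group_set (Sv v).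
Proof.
apply/group_setP; split=> [|sg tau]; rewrite !inE.
  by apply/forallP => x; rewrite perm1.
move=> /forallP Hs /forallP Ht; apply/forallP => x.
by rewrite permM (eqP (Ht _)) (eqP (Hs _)).
Qed.

Lemma at_subsetE (v m : {ffun I -> nat}) f G sg : f \in Lam v m -> sg \in Sv v ->
  sg @: initial v m = G -> at_subset m f G = sym_act sg f.
Proof.
move=> /forallP fL sgS sgG; rewrite /at_subset.
case: pickP => [tau /andP[tauS /eqP tauG]|/(_ sg)]; last by rewrite sgS sgG eqxx.
pose S := Group (Sv_group_set v).
have rS : (tau * sg^-1)%g \in S by rewrite groupM ?groupV.
have := fL (tau * sg^-1)%g; rewrite (rS : _ \in Sv v) /=.
have -> : (tau * sg^-1)%g @: initial v m = initial v m.
  rewrite (eq_imset (g := (sg^-1)%g \o tau)) => [|x]; last by rewrite permM.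
  rewrite imset_comp tauG -sgG -imset_comp -[RHS]imset_id.
  by apply: eq_imset => x /=; rewrite permK.
rewrite eqxx => /eqP {2}<-; rewrite -sym_actM -mulgA mulVg mulg1.
by [].
Qed.

Lemma card_fiber (v : {ffun I -> nat}) i : #|[set x : wvar v | tag x == i]| = v i.
Proof.
have jI : injective (fun r : 'I_(v i) => windex r).
  by move=> r r' /eqP; rewrite eq_Tagged => /eqP.
rewrite -[RHS]card_ord -(card_imset _ jI); apply: eq_card => -[i' r].
rewrite !inE /=; apply/eqP/imsetP => [ii|[r' _ /(congr1 (@tag _ _))]//].
by case: i / ii jI; exists r.
Qed.

Lemma has_dim_initial (v m : {ffun I -> nat}) : leqv m v -> has_dim m (initial v m).
Proof.
move=> /forallP mv; apply/forallP => i; apply/eqP.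
pose j (r : 'I_(m i)) : wvar v :=
  windex (widen_ord (mv i) r).
have jI : injective j.
  by move=> r r' /eqP; rewrite eq_Tagged => /eqP/(congr1 val)/= H; apply: val_inj.
rewrite -[RHS]card_ord -(card_imset _ jI); apply: eq_card => x.
rewrite !inE; apply/andP/imsetP => [[lt /eqP ti]|[r _ ->]]; last by rewrite /= ltn_ord.
case: x lt ti => i' r /= lt ii; case: i / ii => /= in mv j jI *.
by exists (Ordinal lt) => //; congr Tagged; apply: val_inj.
Qed.

Lemma Sv_transitive (v m : {ffun I -> nat}) (G : {set wvar v}) : leqv m v -> has_dim m G ->
  exists2 sg, sg \in Sv v & sg @: initial v m = G.
Proof.
move=> mv Gm; pose S := initial v m.
pose key (A : {set wvar v}) x := (tag x, x \in A).
have cardP A : has_dim m A -> forall p, #|[set x | key A x == p]| =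
   if p.2 then m p.1 else (v p.1 - m p.1)%N.
  move=> /forallP Am [i b] /=; have cA := eqP (Am i).
  case: b; first by rewrite -cA; apply: eq_card => x; rewrite !inE xpair_eqE andbC eqb_id.
  have cv := card_fiber v i.
  rewrite -cA -cv -[#|[set x | _ == i]|](cardsID A).
  rewrite (_ : _ :&: A = [set x in A | tag x == i]); last first.
    by apply/setP => x; rewrite !inE andbC.
  rewrite addKn; apply: eq_card => x; rewrite !inE xpair_eqE eqbF_neg andbC.
  by [].
have card_eq p : #|[set x | key S x == p]| = #|[set x | key G x == p]|.
  by rewrite !cardP //; apply: has_dim_initial.
pose fS x := enum [set y | key S y == key S x].
pose fG x := enum [set y | key G y == key S x].
have fSx x : x \in fS x by rewrite mem_enum inE.
have idx x : (index x (fS x) < size (fG x))%N.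
  by rewrite -cardE -card_eq cardE index_mem.
pose g x := nth x (fG x) (index x (fS x)).
have gE x : key G (g x) = key S x.
  by have := mem_nth x (idx x); rewrite mem_enum inE => /eqP.
have g_inj : injective g.
  move=> x y gxy; have kxy : key S x = key S y by rewrite -!gE gxy.
  have fSxy : fS x = fS y by rewrite /fS kxy.
  have fGxy : fG x = fG y by rewrite /fG kxy.
  move: gxy; rewrite /g fGxy fSxy (set_nth_default y) -?fGxy -?fSxy ?idx // fGxy fSxy.
  move/eqP; rewrite nth_uniq ?enum_uniq ?idx //; last first.
    by rewrite -fGxy -fSxy idx.
  by move/eqP; apply: index_inj; rewrite // -fSxy.
exists (perm g_inj).
  by rewrite inE; apply/forallP => x; rewrite permE; case: (gE x) => -> _.
have gG x : (g x \in G) = (x \in S) by case: (gE x).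
apply/setP => y; apply/imsetP/idP => [[x xS ->]|yG]; first by rewrite permE gG.
exists ((perm g_inj)^-1 y)%g; last by rewrite permKV.
by rewrite -gG -[g _]permE permKV.
Qed.

End Symmetric.

Arguments Lam k {I} E v m.
Arguments restrict {k I E v} v' f.

Section Coulomb.

Context (k : comNzRingType) (I E : finType) (s t : E -> I).

Section Monopole.

Context {v : {ffun I -> nat}}.
Implicit Types (G : {set wvar v}) (m : {ffun I -> nat}).

Definition fmo_num G : tLam k E v :=
  \prod_(e : E) \prod_(x in G | tag x == s e) \prod_(y in ~: G | tag y == t e)
    (w y - w x + theta e - hhbar).

Definition fmo_den G : tLam k E v :=
  \prod_(x in G) \prod_(y in ~: G | tag y == tag x) (w x - w y).

Lemma fmo_den_unit G : inloc v (fmo_den G) \is a GRing.unit.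
Proof.
rewrite /fmo_den rmorph_prod; apply: rpred_prod => x xG.
rewrite rmorph_prod; apply: rpred_prod => y /andP[yG /eqP txy].
have Hd : (tag x == tag y) && (x != y).
  by rewrite txy eqxx; apply: contraTneq yG => <-; rewrite inE xG.
have := toloc_den_unit (@dpoly_reg k I E v) (exist _ (x, y, 0) Hd).
by rewrite /dpoly /= mulr0z addr0.
Qed.

(* The fundamental monopole operator M_m(f); the denominator is a unit of the
   localization by [fmo_den_unit]. *)
Definition fmo m (f : tLam k E v) : tAloc k E v :=
  \sum_(G : {set wvar v} | has_dim m G)
    cst (inloc v (at_subset m f G) * (inloc v (fmo_num G) / inloc v (fmo_den G)))
      * \prod_(x in G) u x.

(* The subring generated by the M_m(f). *)
Inductive in_coulomb : tAloc k E v -> Prop :=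
| in_coulomb_fmo m f : leqv m v -> f \in Lam k E v m -> in_coulomb (fmo m f)
| in_coulomb1 : in_coulomb 1
| in_coulombB a b : in_coulomb a -> in_coulomb b -> in_coulomb (a - b)
| in_coulombM a b : in_coulomb a -> in_coulomb b -> in_coulomb (a * b).

Definition coulomb_pred : {pred tAloc k E v} := [pred a | `[< in_coulomb a >]].

Lemma coulomb_subring_closed : subring_closed coulomb_pred.
Proof.
split=> [|a b|a b]; rewrite !inE.
- exact/asboolP/in_coulomb1.
- by move=> /asboolP Ha /asboolP Hb; apply/asboolP/in_coulombB.
- by move=> /asboolP Ha /asboolP Hb; apply/asboolP/in_coulombM.
Qed.

HB.instance Definition _ :=
  GRing.isSubringClosed.Build (tAloc k E v) coulomb_pred coulomb_subring_closed.

End Monopole.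

(* The algebra A(v). *)
Definition coulomb (v : {ffun I -> nat}) :=
  {a : tAloc k E v | a \in coulomb_pred}.

HB.instance Definition _ v := SubType.on (coulomb v).
HB.instance Definition _ v := [Choice of coulomb v by <:].
HB.instance Definition _ v := [SubChoice_isSubNzRing of coulomb v by <:].

Lemma fmo_in_coulomb (v m : {ffun I -> nat}) f :
  leqv m v -> f \in Lam k E v m -> fmo m f \in coulomb_pred.
Proof. by move=> mv fL; apply/asboolP/in_coulomb_fmo. Qed.

(* M_m(f) as an element of A(v). *)
Definition FMO (v m : {ffun I -> nat}) (f : tLam k E v) (mv : leqv m v)
    (fL : f \in Lam k E v m) : coulomb v :=
  exist _ (fmo m f) (fmo_in_coulomb mv fL).

Definition nedges (i j : I) : nat := #|[set e | (s e == i) && (t e == j)]|.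

Definition cartan (i j : I) : int :=
  2 * (i == j)%:Z - (nedges i j)%:Z - (nedges j i)%:Z.

Definition form (a b : {ffun I -> int}) : int :=
  \sum_(i : I) \sum_(j : I) cartan i j * a i * b j.

(* (a, a) / 2; the form is even, so the division is exact: see [half_formE]. *)
Definition half_form (a : {ffun I -> int}) : int := (form a a %/ 2)%Z.

Lemma half_formE (a : {ffun I -> int}) : 2 * half_form a = form a a.
Proof.
rewrite /half_form; suff [h ->] : exists h, form a a = h * 2 by rewrite mulrC mulzK.
have Esw : \sum_i \sum_j (nedges j i)%:Z * a i * a j =
           \sum_i \sum_j (nedges i j)%:Z * a i * a j.
  rewrite exchange_big; apply: eq_bigr => i _; apply: eq_bigr => j _.
  by rewrite mulrAC.
exists (\sum_i \sum_j ((i == j)%:Z - (nedges i j)%:Z) * a i * a j).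
transitivity (\sum_i \sum_j (2 * (i == j)%:Z - (nedges i j)%:Z) * a i * a j -
              \sum_i \sum_j (nedges j i)%:Z * a i * a j).
  rewrite -sumrB; apply: eq_bigr => i _; rewrite -sumrB; apply: eq_bigr => j _.
  by rewrite /cartan; ring.
rewrite Esw -sumrB mulr_suml; apply: eq_bigr => i _.
by rewrite -sumrB mulr_suml; apply: eq_bigr => j _; ring.
Qed.

End Coulomb.

Definition zvec (I : finType) (m : {ffun I -> nat}) : {ffun I -> int} :=
  [ffun i => (m i)%:Z].

(* A grading of the ring A by the abelian group G. *)
Record is_grading (G : zmodType) (A : nzRingType) (gr : G -> A -> Prop) : Prop := {
  grading0 : forall g, gr g 0;
  gradingB : forall g x y, gr g x -> gr g y -> gr g (x - y);
  grading1 : gr 0 1;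
  gradingM : forall g h x y, gr g x -> gr h y -> gr (g + h) (x * y);
  grading_decomp : forall x, exists (S : seq G) (c : G -> A),
    (forall g, gr g (c g)) /\ x = \sum_(g <- S) c g;
  grading_direct : forall (S : seq G) (c : G -> A), uniq S ->
    (forall g, gr g (c g)) -> \sum_(g <- S) c g = 0 ->
    forall g, g \in S -> c g = 0
}.

(* Main.v *)
From HB Require Import structures.
Require Import Defs.
From mathcomp Require Import all_boot all_order all_fingroup all_algebra mpoly.
From mathcomp Require Import ring boolp.

(* Grading: w, theta and hbar/2 have degree 1, and u_(i,r) has degree
   v_i - sum_(e : s e = i) v_(t e); the v-dependence of this weight cancels the
   one coming from the products over s outside Gamma in M_m(f).

   Restriction: it suffices to remove one variable z over the vertex i.  As u_z
   only occurs with nonnegative exponents, there is a ring morphism killing u_z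
   and setting w_z = 0.  It kills the terms with z in Gamma, and multiplies each
   other term of M_m(f~) by a product over x in Gamma of
     prod_(e : s e = tag x, t e = i) (theta_e - hbar/2 - w_x) / w_x
   (the denominator being present only if x is over i).  These factors depend on
   w_x alone, so rescaling u_x absorbs them, once w_x + n hbar and
   w_x - theta_e + hbar/2 + n hbar are inverted.  Both algebras thus map to the
   same localization, the smaller one injectively, and corresponding monopole
   operators have the same image.

   Surjectivity: an invariant f' lifts to the alternating sum, over the nonempty
   subsets T of the block of z, of the polynomials obtained from f' by using the
   variables outside T and replacing those in T by 0. *)

Set Implicit Arguments.
Unset Strict Implicit.
Unset Printing Implicit Defensive.

Import GRing.Theory.

Local Open Scope ring_scope.

(* [tAloc_universal] maps into rings with a unit structure; any ring has one. *)
Definition classical (R : nzRingType) : Type := R.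

Section ClassicalUnits.

Context (R : nzRingType).

HB.instance Definition _ := GRing.NzRing.on (classical R).

Let two_sided (x : classical R) := exists y : classical R, y * x = 1 /\ x * y = 1.

Definition classical_unit : {pred classical R} := [pred x | `[< two_sided x >]].

Definition classical_inv (x : classical R) : classical R :=
  if pselect (two_sided x) is left H then projT1 (cid H) else x.

Let mulVx : {in classical_unit, left_inverse 1 classical_inv *%R}.
Proof.
by move=> x /asboolP Hx; rewrite /classical_inv; case: pselect => // H; case: (cid H) => y [].
Qed.

Let mulxV : {in classical_unit, right_inverse 1 classical_inv *%R}.
Proof.
by move=> x /asboolP Hx; rewrite /classical_inv; case: pselect => // H; case: (cid H) => y [].
Qed.

Let unitP (x y : classical R) : y * x = 1 /\ x * y = 1 -> classical_unit x.
Proof. by move=> H; apply/asboolP; exists y. Qed.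

Let inv_out : {in [predC classical_unit], classical_inv =1 id}.
Proof. by move=> x /asboolP Hx; rewrite /classical_inv; case: pselect. Qed.

HB.instance Definition _ :=
  GRing.NzRing_hasMulInverse.Build (classical R) mulVx mulxV unitP inv_out.

End ClassicalUnits.

(** * Morphisms between rings of difference operators *)

Section ParameterSubstitution.

Context (k : comNzRingType) (I E I' E' : finType).
Context {v : {ffun I -> nat}} {v' : {ffun I' -> nat}} (h : var E v -> tLam k E' v').

(** [wsubst] fixes hbar/2 and theta_e and keeps the quiver; here theta_e has to go to an expression
    in the variables of a different quiver. *)
Definition psubst (p : tLam k E v) : tLam k E' v' :=
  mmap (@mpolyC #|var E' v'| k) (fun i => h (enum_val i)) p.

Lemma psubst_is_zmod_morphism : zmod_morphism psubst.
Proof. exact: raddfB. Qed.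

Lemma psubst_is_monoid_morphism : monoid_morphism psubst.
Proof. by split=> [|p q]; [apply: rmorph1 | apply: rmorphM]. Qed.

HB.instance Definition _ := GRing.isZmodMorphism.Build (tLam k E v) (tLam k E' v')
  psubst psubst_is_zmod_morphism.
HB.instance Definition _ := GRing.isMonoidMorphism.Build (tLam k E v) (tLam k E' v')
  psubst psubst_is_monoid_morphism.

Lemma psubst_vX x : psubst (vX x) = h x.
Proof. by rewrite /psubst /vX mmapX mmap1U enum_rankK. Qed.

Lemma psubst_C c : psubst c%:MP = c%:MP.
Proof. by rewrite /psubst mmapC. Qed.

End ParameterSubstitution.

Lemma cst_comm (k : comNzRingType) (I E : finType) (v : {ffun I -> nat})
    (c d : loc (@dpoly_reg k _ E v)) : cst c * cst d = cst d * cst c.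
Proof. by rewrite -[LHS]rmorphM mulrC rmorphM. Qed.

Section Twist.

Context (k : comNzRingType) (I E I' E' : finType).
Context {v : {ffun I -> nat}} {v' : {ffun I' -> nat}}.
Context (P : {rmorphism tLam k E v -> tLam k E' v'}) (ka : wvar v -> wvar v').
Context (F : wvar v -> loc (@dpoly_reg k _ E' v')).

Hypothesis P_C : forall c : k, P c%:MP = c%:MP.
Hypothesis P_param : forall x c, F x != 0 ->
  shift U_(enum_rank (ka x)) (P (vX (inl c))) = P (vX (inl c)).
Hypothesis P_w : forall x y, F x != 0 ->
  shift U_(enum_rank (ka x)) (P (w y)) = P (w y + hbar *+ (x == y)).
Hypothesis P_unit : forall d : dfactor v, inloc v' (P (dpoly k E d)) \is a GRing.unit.
Hypothesis F_shift : forall x y, F x != 0 -> x != y ->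
  Defs.lshift U_(enum_rank (ka x))%MM (F y) = F y.

Definition twist_loc : loc (@dpoly_reg k _ E v) -> loc (@dpoly_reg k _ E' v') :=
  @loc_liftr _ _ _ _ _ (inloc v' \o P) P_unit.

HB.instance Definition _ := GRing.RMorphism.on twist_loc.

Lemma twist_locE p : twist_loc (inloc v p) = inloc v' (P p).
Proof. exact: (@loc_liftE _ _ _ _ _ (inloc v' \o P) P_unit). Qed.

Let Ut (x : wvar v) : tAloc k E' v' := cst (F x) * u (ka x).

Let Ut_cst x c : Ut x * cst c = cst (Defs.lshift U_(enum_rank (ka x))%MM c) * Ut x.
Proof. by rewrite /Ut -mulrA umon_cst !mulrA cst_comm. Qed.

Let Ut0 x : F x = 0 -> Ut x = 0.
Proof. by move=> F0; rewrite /Ut F0 rmorph0 mul0r. Qed.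

Let Ut_comm x y : Ut x * Ut y = Ut y * Ut x.
Proof.
have [->//|nxy] := eqVneq x y.
have [/Ut0->|Fx] := eqVneq (F x) 0; first by rewrite mulr0 mul0r.
have [/Ut0->|Fy] := eqVneq (F y) 0; first by rewrite mulr0 mul0r.
have cstu a b : Defs.lshift U_(enum_rank (ka a))%MM (F b) = F b ->
    Ut a * Ut b = cst (F b * F a) * (u (ka a) * u (ka b)).
  by move=> Fab; rewrite {2}/Ut mulrA Ut_cst Fab /Ut rmorphM !mulrA.
by rewrite !cstu ?F_shift // 1?eq_sym // mulrC u_comm.
Qed.

(** The prescribed images satisfy the defining relations, so [tAloc_universal] applies. When F x = 0
    the image of u_x is 0 and its relations are trivial, which is why compatibility with shifts is
    assumed for F x != 0 only. *)
Lemma twist_exists : exists Psi : {rmorphism tAloc k E v -> tAloc k E' v'},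
  (forall c, Psi (cst c) = cst (twist_loc c)) /\
  (forall x, Psi (u x) = cst (F x) * u (ka x)).
Proof.
pose phi : {rmorphism tLam k E v -> classical (tAloc k E' v')} :=
  @cst k I' E' v' \o inloc v' \o P.
have phiU x p : (F x != 0 -> shift U_(enum_rank (ka x)) (P p) = P p) ->
    GRing.comm (Ut x) (phi p).
  move=> Pp; have [F0|/Pp{}Pp] := eqVneq (F x) 0.
    by rewrite /GRing.comm Ut0 // mulr0 mul0r.
  by rewrite /GRing.comm /= [LHS]Ut_cst lshiftE Pp.
have := @tAloc_universal k I E v (classical (tAloc k E' v')) phi Ut.
case=> [x c|x c|x y|x y|d|Psi [Psi_c Psi_u]].
- by apply: phiU => _; rewrite P_C shift_C.
- by apply: phiU; apply: P_param.
- have [/Ut0->|F0] := eqVneq (F x) 0; first by rewrite mulr0 mul0r.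
  by rewrite /= [LHS]Ut_cst lshiftE P_w // rmorphD /= rmorphD.
- exact: Ut_comm.
- have dU := P_unit d; apply/unitrP; exists (cst (inloc v' (P (dpoly k E d)))^-1).
  by split; rewrite /= -[LHS]rmorphM ?mulVr ?mulrV // rmorph1.
exists Psi; split=> // c.
by apply: (@loc_rmorph_ext _ _ _ _ _ (Psi \o @cst k I E v) (@cst k I' E' v' \o twist_loc))
  => p /=;  rewrite twist_locE Psi_c.
Qed.

End Twist.

Section TwistedMonomials.

Context (k : comNzRingType) (I' E' : finType) (T : eqType).
Context {v' : {ffun I' -> nat}} (ka : T -> wvar v').

(** Collecting the scalars on the left moves each u past the scalars of the later factors. Those
    belong to other indices, as r has no repetition, so the shift fixes them; if some F x vanishes,
    both sides do. *)
Lemma prod_twisted (F : T -> loc (@dpoly_reg k _ E' v')) (r : seq T) :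
  (forall x y, F x != 0 -> x != y -> Defs.lshift U_(enum_rank (ka x))%MM (F y) = F y) ->
  uniq r ->
  \prod_(x <- r) (cst (F x) * u (ka x)) =
  cst (\prod_(x <- r) F x) * umon k E' (\sum_(x <- r) U_(enum_rank (ka x)))%MM :> tAloc k E' v'.
Proof.
move=> Fs; elim: r => [_|x r IHr /= /andP[xr ur]].
  by rewrite !big_nil umon0 rmorph1 mulr1.
have [F0|Fx] := eqVneq (F x) 0; first by rewrite !big_cons F0 !(mul0r, rmorph0).
rewrite !big_cons {}IHr // mulrA -[cst (F x) * _ * _]mulrA umon_cst rmorph_prod /=.
have -> : \prod_(y <- r) Defs.lshift U_(enum_rank (ka x))%MM (F y) = \prod_(y <- r) F y.
  apply: eq_big_seq => y yr; apply: Fs => //; apply: contraNneq xr => ->; exact: yr.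
by rewrite umonD rmorphM !mulrA.
Qed.

Lemma prod_u (r : seq T) :
  \prod_(x <- r) u (ka x) = umon k E' (\sum_(x <- r) U_(enum_rank (ka x)))%MM :> tAloc k E' v'.
Proof.
by elim: r => [|x r IHr]; rewrite ?big_nil ?umon0 // !big_cons IHr umonD.
Qed.

End TwistedMonomials.

Section TwistInjective.

Context (k : comNzRingType) (I E I' E' : finType).
Context {v : {ffun I -> nat}} {v' : {ffun I' -> nat}}.
Context (P : {rmorphism tLam k E v -> tLam k E' v'}) (ka : wvar v -> wvar v').
Hypothesis P_unit : forall d : dfactor v, inloc v' (P (dpoly k E d)) \is a GRing.unit.

(** If a fraction goes to 0, multiplying by the image of its denominator shows that its numerator
    goes to 0 under P. *)
Lemma twist_loc_inj : injective P -> injective (twist_loc P_unit).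
Proof.
move=> Pinj; apply: raddf_inj => x /=; rewrite -(lfracK x) lfracE rmorphM /= twist_locE.
have dU := toloc_denom_unit (@dpoly_reg k _ E v) (lden x).
move/(congr1 (fun y => y * twist_loc P_unit (inloc v (denom (dpoly k E (v:=v)) (lden x))))).
rewrite mul0r -mulrA -rmorphM mulVr // rmorph1 mulr1 => /eqP.
rewrite -(rmorph0 (inloc v')) (inj_eq (@toloc_inj _ _ _ _)) -(rmorph0 P).
by move=> /eqP/Pinj ->; rewrite rmorph0 mul0r.
Qed.

(** As [ka] is injective, so is the induced map [kmon] on exponents. Hence the coefficient of Psi f
    at [kmon b] is the image of the single coefficient of f at b, and [twist_loc_inj] concludes. *)
Lemma twist_inj (Psi : {rmorphism tAloc k E v -> tAloc k E' v'}) :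
  injective P -> injective ka ->
  (forall c, Psi (cst c) = cst (twist_loc P_unit c)) ->
  (forall x, Psi (u x) = u (ka x)) -> injective Psi.
Proof.
move=> Pinj kinj Psi_c Psi_u; pose kmon (a : 'X_{1..#|wvar v|}) :=
  (\sum_i U_(enum_rank (ka (enum_val i))) *+ a i)%MM : 'X_{1..#|wvar v'|}.
have kmonE a j : kmon a (enum_rank (ka (enum_val j))) = a j.
  rewrite /kmon mnm_sumE (bigD1 j) //= mulmnE mnm1E eqxx mul1n big1 ?addn0 // => i ij.
  rewrite mulmnE mnm1E (inj_eq enum_rank_inj) (inj_eq kinj) (inj_eq enum_val_inj).
  by rewrite (negPf ij).
have kmon_inj : injective kmon.
  by move=> a b ab; apply/mnmP => j; rewrite -!kmonE ab.
have Psi_m a : Psi (umon k E a) = umon k E' (kmon a).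
  rewrite umon_prod rmorph_prod /kmon; elim: (index_enum _) => [|i r IHr].
    by rewrite !big_nil umon0.
  rewrite !big_cons umonD IHr rmorphXn /= Psi_u; congr (_ * _).
  by elim: (a i) => [|n IHn]; rewrite ?expr0 ?umon0 // exprS mulmS umonD IHn.
apply: raddf_inj => f /= Pf0; apply/mpolyP => b; rewrite mcoeff0.
apply: (twist_loc_inj Pinj); rewrite rmorph0.
have := congr1 (fun g : tAloc k E' v' => (g : {mpoly _[_]})@_(kmon b)) Pf0.
rewrite mcoeff0 => <-; rewrite [in RHS](tAloc_basis f) rmorph_sum raddf_sum /=.
under eq_bigr => a _ do rewrite rmorphM /= Psi_c Psi_m cst_umon mcoeffZ mcoeffX (inj_eq kmon_inj).
have [bf|bf] := boolP (b \in msupp f).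
  rewrite (bigD1_seq b) //= eqxx mulr1 big1 ?addr0 // => a ab.
  by rewrite (negPf ab) mulr0.
rewrite (memN_msupp_eq0 bf) rmorph0 big_seq big1 // => a af.
by case: eqP => [ab|_]; [rewrite -ab af in bf | rewrite mulr0].
Qed.

End TwistInjective.

(** * Removing one variable over a vertex: permutations, subsets, invariants *)

Lemma SvP (I : finType) (v : {ffun I -> nat}) (sg : {perm wvar v}) :
  reflect (forall x, tag (sg x) = tag x) (sg \in Sv v).
Proof. by rewrite inE; apply: (iffP forallP) => H x; apply/eqP. Qed.

Lemma wvar_eq (I : finType) (v : {ffun I -> nat}) (x y : wvar v) :
  tag x = tag y -> wpos x = wpos y :> nat -> x = y.
Proof.
case: x y => i r [j r'] /= ij; case: j / ij r' => r' H.
by congr Tagged; apply: val_inj.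
Qed.

HB.instance Definition _ (k : comNzRingType) (I E : finType) (v v' : {ffun I -> nat}) :=
  GRing.RMorphism.on (@restrict k I E v v').

HB.instance Definition _ (k : comNzRingType) (I E : finType) (v : {ffun I -> nat}) sg :=
  GRing.RMorphism.on (@sym_act k I E v sg).

Section SymAct.

Context (k : comNzRingType) (I E : finType) (v : {ffun I -> nat}).
Implicit Type sg : {perm wvar v}.

Lemma sym_act_w sg x : sym_act sg (w x) = w (sg x) :> tLam k E v.
Proof. exact: wsubst_w. Qed.

Lemma sym_act_l sg c : sym_act sg (vX (inl c)) = vX (inl c) :> tLam k E v.
Proof. exact: wsubst_l. Qed.

Lemma sym_act_C sg c : sym_act sg c%:MP = c%:MP :> tLam k E v.
Proof. exact: wsubst_C. Qed.

Lemma LamP m (f : tLam k E v) :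
  reflect (forall sg, sg \in Sv v -> sg @: initial v m = initial v m -> sym_act sg f = f)
          (f \in Lam k E v m).
Proof.
apply: (iffP forallP) => [H sg sgS sgm|H sg].
  by have := H sg; rewrite sgS sgm eqxx /= => /eqP.
by apply/implyP => sgS; apply/implyP => /eqP sgm; apply/eqP/H.
Qed.

End SymAct.

Section OneStep.

Context (I : finType) (v v' : {ffun I -> nat}) (i0 : I).
Hypothesis vS : forall j, v j = (v' j + (j == i0))%N.

Lemma step_le j : (v' j <= v j)%N.
Proof. by rewrite vS leq_addr. Qed.

Lemma step_lt : (v' i0 < v i0)%N.
Proof. by rewrite vS eqxx addn1. Qed.

Definition incl (y : wvar v') : wvar v := windex (widen_ord (step_le (tag y)) (wpos y)).

(** The variable z to be removed. Positions being 0-based, v' i0 is the last one over [i0]. *)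
Definition zvar : wvar v := windex (Ordinal step_lt).

Lemma incl_inj : injective incl.
Proof.
move=> x y xy; have txy := congr1 (@tag _ _) xy.
have rxy := congr1 (fun x : wvar v => nat_of_ord (wpos x)) xy.
by apply: wvar_eq; [apply: txy | apply: rxy].
Qed.

Lemma incl_neq y : incl y != zvar.
Proof.
apply/eqP => H; have := congr1 (@tag _ _) H => /= ti.
have := congr1 (fun x => nat_of_ord (wpos x)) H => /= r.
by have := ltn_ord (wpos y); rewrite r ti ltnn.
Qed.

Lemma stepP x : x != zvar -> exists y, x = incl y.
Proof.
move=> nz; have rv : (wpos x < v' (tag x))%N.
  have := ltn_ord (wpos x); rewrite {2}vS.
  case: eqP => [ji|_]; last by rewrite addn0.
  rewrite addn1 ltnS leq_eqVlt => /orP[/eqP r|//].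
  by case/eqP: nz; apply: wvar_eq; rewrite //= r ji.
by exists (windex (Ordinal rv)); apply: wvar_eq.
Qed.

Definition unincl (x : wvar v) : option (wvar v') := [pick y | incl y == x].

Lemma inclK y : unincl (incl y) = Some y.
Proof.
by rewrite /unincl; case: pickP => [x /eqP/incl_inj->|/(_ y)/eqP].
Qed.

Lemma unincl_z : unincl zvar = None.
Proof.
by rewrite /unincl; case: pickP => // x; rewrite (negPf (incl_neq x)).
Qed.

Lemma step_split (x : wvar v) (T : wvar v -> Type) :
  T zvar -> (forall y, T (incl y)) -> T x.
Proof.
move=> Tz Ti; have [->//|/stepP nz] := eqVneq x zvar.
by case: (cid nz) => y ->.
Qed.

Definition extend_fun (sg : {perm wvar v'}) (x : wvar v) : wvar v :=
  if unincl x is Some y then incl (sg y) else x.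

Lemma extend_fun_inj sg : injective (extend_fun sg).
Proof.
have Ez : extend_fun sg zvar = zvar by rewrite /extend_fun unincl_z.
have Ei y : extend_fun sg (incl y) = incl (sg y) by rewrite /extend_fun inclK.
move=> x y; elim/step_split: x => [|x]; elim/step_split: y => [|y]; rewrite ?Ez ?Ei //.
- by move/esym/eqP; rewrite (negPf (incl_neq _)).
- by move/eqP; rewrite (negPf (incl_neq _)).
- by move=> /incl_inj/perm_inj->.
Qed.

Definition extend_perm sg : {perm wvar v} := perm (@extend_fun_inj sg).

Lemma extend_incl sg y : extend_perm sg (incl y) = incl (sg y).
Proof. by rewrite permE /extend_fun inclK. Qed.

Lemma extend_z sg : extend_perm sg zvar = zvar.
Proof. by rewrite permE /extend_fun unincl_z. Qed.

Lemma extend_Sv sg : sg \in Sv v' -> extend_perm sg \in Sv v.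
Proof.
move=> /SvP H; apply/SvP => x; elim/step_split: x => [|y].
  by rewrite extend_z.
by rewrite extend_incl /= H.
Qed.

Lemma restrict_perm (sg : {perm wvar v}) : sg zvar = zvar ->
  exists tau : {perm wvar v'}, forall y, sg (incl y) = incl (tau y).
Proof.
move=> sgz; have niz y : sg (incl y) != zvar.
  by rewrite -sgz (inj_eq perm_inj) incl_neq.
pose g y := projT1 (cid (stepP (niz y))).
have gE y : sg (incl y) = incl (g y) by rewrite /g; case: (cid _).
have g_inj : injective g.
  by move=> x y /(congr1 incl); rewrite -!gE => /perm_inj/incl_inj.
by exists (perm g_inj) => y; rewrite permE.
Qed.

Lemma initial_incl m y : (incl y \in initial v m) = (y \in initial v' m).
Proof. by rewrite !inE. Qed.

Lemma initial_z m : (zvar \in initial v m) = (v' i0 < m i0)%N.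
Proof. by rewrite inE. Qed.

Lemma imset_incl_split (G : {set wvar v}) : zvar \notin G -> incl @: (incl @^-1: G) = G.
Proof.
move=> zG; apply/setP => x; elim/step_split: x => [|y].
  rewrite (negPf zG); apply/imsetP => -[y _ H].
  by case/eqP: (incl_neq y).
by rewrite mem_imset ?inE //; apply: incl_inj.
Qed.

Lemma initial_imset m : leqv m v' -> initial v m = incl @: initial v' m.
Proof.
move=> /forallP mv; rewrite -[LHS]imset_incl_split ?initial_z -?leqNgt //.
suff -> : incl @^-1: initial v m = initial v' m by [].
by apply/setP => y; rewrite inE initial_incl.
Qed.

Lemma has_dim_incl m (G : {set wvar v'}) : has_dim m (incl @: G) = has_dim m G.
Proof.
apply: eq_forallb => j; rewrite -(card_imset _ incl_inj); congr (_ == _).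
apply: eq_card => x; elim/step_split: x => [|y]; rewrite !inE.
  apply/andP/imsetP => [[/imsetP[y _ H]]|[y _ H]]; by case/eqP: (incl_neq y).
by rewrite !mem_imset ?inE //; apply: incl_inj.
Qed.

(** Since v and v' differ by one at [i0] only, m must equal v there, so G contains the whole fibre
    over [i0]. *)
Lemma zvar_in m (G : {set wvar v}) : leqv m v -> ~~ leqv m v' -> has_dim m G -> zvar \in G.
Proof.
move=> /forallP mv; rewrite negb_forall => /existsP[j]; rewrite -ltnNge => lt.
have ji : j = i0.
  by apply: contraTeq (mv j) => ji; rewrite vS (negPf ji) addn0 -ltnNge.
rewrite {j}ji in lt *; move/forallP/(_ i0)/eqP => Gm.
have mi : m i0 = v i0.
  by apply/eqP; rewrite eqn_leq mv /= vS eqxx addn1.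
have sub : [set x in G | tag x == i0] \subset [set x : wvar v | tag x == i0].
  by apply/subsetP => x; rewrite !inE => /andP[].
have /setP/(_ zvar) : [set x in G | tag x == i0] = [set x : wvar v | tag x == i0].
  by apply/eqP; rewrite eqEcard sub card_fiber -mi Gm leqnn.
by rewrite !inE eqxx andbT.
Qed.

Section Restriction.

Context (k : comNzRingType) (E : finType).
Local Notation rho := (@restrict k I E v v').

Lemma restrict_incl y : rho (w (incl y)) = w y.
Proof.
rewrite /restrict wsubst_w /=; case: insubP => [r _ /= H|]; last by rewrite ltn_ord.
by congr w; apply: wvar_eq => //=; rewrite H.
Qed.

Lemma restrict_z : rho (w zvar) = 0.
Proof. by rewrite /restrict wsubst_w /=; case: insubP => //=; rewrite ltnn. Qed.

Lemma restrict_l c : rho (vX (inl c)) = vX (inl c).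
Proof. exact: wsubst_l. Qed.

Lemma restrict_C c : rho c%:MP = c%:MP.
Proof. exact: wsubst_C. Qed.

Lemma restrict_sym_act (sg : {perm wvar v}) (tau : {perm wvar v'}) f :
  sg zvar = zvar -> (forall y, sg (incl y) = incl (tau y)) ->
  rho (sym_act sg f) = sym_act tau (rho f).
Proof.
move=> sgz sgi.
apply: (@wsubst_ext _ _ _ _ _ (rho \o sym_act sg) (sym_act tau \o rho)) => [c|c|x] /=.
- by rewrite !(sym_act_C, restrict_C).
- by rewrite !(sym_act_l, restrict_l).
rewrite sym_act_w; elim/step_split: x => [|y]; first by rewrite sgz restrict_z rmorph0.
by rewrite sgi !restrict_incl sym_act_w.
Qed.

Lemma restrict_extend sg f : rho (sym_act (extend_perm sg) f) = sym_act sg (rho f).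
Proof. by apply: restrict_sym_act; [apply: extend_z | apply: extend_incl]. Qed.

Lemma extend_imset (sg : {perm wvar v'}) (A : {set wvar v'}) :
  extend_perm sg @: (incl @: A) = incl @: (sg @: A).
Proof. by rewrite -!imset_comp; apply: eq_imset => y /=; rewrite extend_incl. Qed.

Lemma restrict_Lam m f : leqv m v' -> f \in Lam k E v m -> rho f \in Lam k E v' m.
Proof.
move=> mv /LamP fL; apply/LamP => sg sgS sgm; rewrite -restrict_extend fL //.
  exact: extend_Sv.
by rewrite initial_imset // extend_imset sgm.
Qed.

(** By [at_subsetE] any suitable permutation computes f|_Gamma. One that extends a permutation of
    the smaller set by fixing z commutes with setting w_z = 0. *)
Lemma restrict_at_subset m f (G : {set wvar v'}) : leqv m v' -> f \in Lam k E v m ->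
  has_dim m G -> rho (at_subset m f (incl @: G)) = at_subset m (rho f) G.
Proof.
move=> mv fL Gm; have [sg sgS sgG] := Sv_transitive mv Gm.
rewrite (at_subsetE (restrict_Lam mv fL) sgS sgG) -restrict_extend.
congr restrict; apply: at_subsetE => //; first exact: extend_Sv.
by rewrite initial_imset // extend_imset sgG.
Qed.

Definition inflate : tLam k E v' -> tLam k E v := wsubst (fun y => w (incl y)).

HB.instance Definition _ := GRing.RMorphism.on inflate.

Lemma inflateK : cancel inflate rho.
Proof.
move=> p; apply: (@wsubst_ext _ _ _ _ _ (rho \o inflate) idfun) => [c|c|y] /=.
- by rewrite /inflate wsubst_C restrict_C.
- by rewrite /inflate wsubst_l restrict_l.
- by rewrite /inflate wsubst_w restrict_incl.
Qed.

Lemma sym_act_inflate (sg : {perm wvar v}) (tau : {perm wvar v'}) p :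
  (forall y, sg (incl y) = incl (tau y)) ->
  sym_act sg (inflate p) = inflate (sym_act tau p).
Proof.
move=> sgi; rewrite /sym_act /inflate !wsubst_comp; apply: eq_wsubst => y.
by rewrite !wsubst_w sgi.
Qed.

End Restriction.
End OneStep.

(** * The common localization and the two maps into it *)

Section Comparison.

Context (k : comNzRingType) (I E : finType) (s t : E -> I).
Context (v v' : {ffun I -> nat}) (i0 : I).
Hypothesis vS : forall j, v j = (v' j + (j == i0))%N.

Local Notation incl := (incl vS).
Local Notation z := (zvar vS).
Local Notation rho := (@restrict k I E v v').

(* The common target is the algebra [tAloc] of a single vertex with one variable
   [pt a] for each [a : point] and no edge: there all differences of variables
   are invertible.  With W_0 = w (pt (inr None)), it receives w_x as
   w (pt (inl x)) - W_0 and theta_e - hbar/2 as w (pt (inr (Some e))) - W_0, so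
   that w_x and theta_e - hbar/2 - w_x become differences. *)
Definition point : finType := (wvar v' + option E)%type.

Definition vpt : {ffun unit -> nat} := [ffun _ => #|point|].

Definition pt (a : point) : wvar vpt :=
  windex (cast_ord (esym (ffunE (fun _ : unit => #|point|) tt)) (enum_rank a)).

Lemma pt_inj : injective pt.
Proof.
move=> a b ab; have := congr1 (fun x : wvar vpt => nat_of_ord (wpos x)) ab.
by move=> /= /ord_inj/enum_rank_inj.
Qed.

Local Notation tL := (tLam k void vpt).

Definition loc_param_var (x : var E v') : tL :=
  match x with
  | inl None => hhbar
  | inl (Some e) => w (pt (inr (Some e))) - w (pt (inr None)) + hhbar
  | inr y => w (pt (inl y)) - w (pt (inr None))
  end.

Local Notation J := (psubst loc_param_var).

Lemma J_hhbar : J hhbar = hhbar. Proof. exact: psubst_vX. Qed.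

Lemma J_hbar : J hbar = hbar. Proof. by rewrite /hbar rmorphMn /= J_hhbar. Qed.

Lemma J_theta e : J (theta e) = w (pt (inr (Some e))) - w (pt (inr None)) + hhbar.
Proof. exact: psubst_vX. Qed.

Lemma J_w y : J (w y) = w (pt (inl y)) - w (pt (inr None)).
Proof. exact: psubst_vX. Qed.

(** Setting W_0 = 0 undoes [J], so this substitution gives a left inverse. *)
Definition retract_var (x : var void vpt) : tLam k E v' :=
  match x with
  | inl None => hhbar
  | inl (Some e) => 0
  | inr x =>
    match [pick a | pt a == x] with
    | Some (inl y) => w y
    | Some (inr (Some e)) => theta e - hhbar
    | _ => 0
    end
  end.

Lemma J_inj : injective J.
Proof.
apply: (can_inj (g := psubst retract_var)) => p.
have rw a : psubst retract_var (w (pt a)) = retract_var (inr (pt a)) by apply: psubst_vX.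
have rh : psubst retract_var hhbar = hhbar by apply: psubst_vX.
have rE a : [pick b | pt b == pt a] = Some a.
  by case: pickP => [b /eqP/pt_inj->|/(_ a)/eqP].
apply: (@tLam_rmorph_ext _ _ _ _ _ (psubst retract_var \o J) idfun) => [c|x] /=.
  by rewrite !psubst_C.
rewrite psubst_vX; case: x => [[e|]|y] //=.
- by rewrite rmorphD rmorphB /= !rw rh /= !rE subr0 subrK.
- by rewrite rmorphB /= !rw /= !rE subr0.
Qed.


Lemma pt_unit a b n : a != b -> inloc vpt (w (pt a) - w (pt b) + hbar *~ n : tL) \is a GRing.unit.
Proof.
move=> ab; have Hd : (tag (pt a) == tag (pt b)) && (pt a != pt b).
  by rewrite (inj_eq pt_inj) ab andbT.
exact: (toloc_den_unit (@dpoly_reg k _ void vpt) (exist _ (pt a, pt b, n) Hd)).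
Qed.

Lemma pt_unit0 a b : a != b -> inloc vpt (w (pt a) - w (pt b) : tL) \is a GRing.unit.
Proof. by move=> ab; have := pt_unit 0 ab; rewrite mulr0z addr0. Qed.

(** z shares the point of W_0: then w_z goes to W_0 - W_0 = 0, while differences w_x - w_z still go
    to differences of distinct points. *)
Definition lift_pt (x : wvar v) : point :=
  if unincl vS x is Some y then inl y else inr None.

Lemma lift_pt_incl y : lift_pt (incl y) = inl y.
Proof. by rewrite /lift_pt inclK. Qed.

Lemma lift_pt_z : lift_pt z = inr None.
Proof. by rewrite /lift_pt unincl_z. Qed.

Lemma lift_pt_inj : injective lift_pt.
Proof.
move=> x y; elim/(step_split (vS := vS)): x => [|x]; elim/(step_split (vS := vS)): y => [|y].
- by [].
- by rewrite lift_pt_incl lift_pt_z.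
- by rewrite lift_pt_incl lift_pt_z.
- by rewrite !lift_pt_incl => -[->].
Qed.

Local Notation J1 := (J \o rho).

Lemma J1_w x : J (rho (w x)) = w (pt (lift_pt x)) - w (pt (inr None)).
Proof.
elim/(step_split (vS := vS)): x => [|x].
  by rewrite restrict_z rmorph0 lift_pt_z subrr.
by rewrite restrict_incl J_w lift_pt_incl.
Qed.

Lemma restrict_hbar : rho hbar = hbar.
Proof. exact: wsubst_hbar. Qed.

Lemma J1_hbar n : J (rho (hbar *+ n)) = hbar *+ n.
Proof. by rewrite -[LHS]/(J1 _) rmorphMn; congr (_ *+ n); rewrite /= restrict_hbar J_hbar. Qed.

Lemma J1_unit (d : dfactor v) : inloc vpt (J1 (dpoly k E d)) \is a GRing.unit.
Proof.
case: d => -[[x y] n] /= H; have nxy : x != y by case/andP: H.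
have -> : J (rho (dpoly k E (exist _ (x, y, n) H))) =
    w (pt (lift_pt x)) - w (pt (lift_pt y)) + hbar *~ n.
  rewrite /dpoly /= rmorphD rmorphB rmorphMz /= restrict_hbar rmorphD rmorphB rmorphMz /= J_hbar.
  by rewrite !J1_w; ring.
by apply: pt_unit; rewrite (inj_eq lift_pt_inj).
Qed.

Lemma J_unit (d : dfactor v') : inloc vpt (J (dpoly k E d)) \is a GRing.unit.
Proof.
case: d => -[[x y] n] /= H; have nxy : x != y by case/andP: H.
have -> : J (dpoly k E (exist _ (x, y, n) H)) =
    w (pt (inl x)) - w (pt (inl y)) + hbar *~ n.
  by rewrite /dpoly /= rmorphD rmorphB rmorphMz /= J_hbar !J_w; ring.
by apply: pt_unit.
Qed.

Local Notation emb := (inloc vpt : tL -> loc (@dpoly_reg k _ void vpt)).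

(** With w_z = 0, the index s = z contributes theta_e - hbar/2 - w_y to the numerator of a monopole
    operator and w_y to its denominator. [edge_factor] and [vertex_factor] are the images under [J]
    of these contributions. *)
Definition edge_factor y : tL :=
  \prod_(e | (s e == tag y) && (t e == i0)) (w (pt (inr (Some e))) - w (pt (inl y))).

Definition vertex_factor y : tL :=
  if tag y == i0 then w (pt (inl y)) - w (pt (inr None)) else 1.

Lemma edge_factor_unit y : emb (edge_factor y) \is a GRing.unit.
Proof. by rewrite rmorph_prod; apply: rpred_prod => e _; apply: pt_unit0. Qed.

Lemma vertex_factor_unit y : emb (vertex_factor y) \is a GRing.unit.
Proof.
by rewrite /vertex_factor; case: eqP => _; [apply: pt_unit0 | rewrite rmorph1 unitr1].
Qed.

(** The inverse of the extra factor attached to y, to be absorbed into u_y; the value 0 at z kills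
    u_z. *)
Definition correction (x : wvar v) : loc (@dpoly_reg k _ void vpt) :=
  if unincl vS x is Some y then emb (vertex_factor y) / emb (edge_factor y) else 0.

Lemma correction_incl y : correction (incl y) = emb (vertex_factor y) / emb (edge_factor y).
Proof. by rewrite /correction inclK. Qed.

Lemma correction_z : correction z = 0.
Proof. by rewrite /correction unincl_z. Qed.

Lemma shift_pt a b : shift U_(enum_rank (pt a)) (w (pt b) : tL) = w (pt b) + hbar *+ (a == b).
Proof. by rewrite shift_w mnm1E (inj_eq enum_rank_inj) (inj_eq pt_inj). Qed.

Lemma shift_pt_neq a b : a != b -> shift U_(enum_rank (pt a)) (w (pt b) : tL) = w (pt b).
Proof. by move=> ab; rewrite shift_pt (negPf ab) addr0. Qed.

Lemma shift_J_l y c :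
  shift U_(enum_rank (pt (inl y))) (J (vX (inl c))) = J (vX (inl c)).
Proof.
case: c => [e|]; last by rewrite [J _]J_hhbar; apply: shift_l.
by rewrite [J _]J_theta rmorphD rmorphB /= !shift_pt_neq // (shift_l _ _ None).
Qed.

(** Apart from W_0 and the points of the edges, the correction at y involves W_y only, which u_x
    does not shift. The case x = z has to be excluded because its point is that of W_0. *)
Lemma shift_correction x y : x != y -> correction x != 0 ->
  Defs.lshift U_(enum_rank (pt (lift_pt x)))%MM (correction y) = correction y.
Proof.
elim/(step_split (vS := vS)): x => [|x]; first by rewrite correction_z eqxx.
elim/(step_split (vS := vS)): y => [|y]; first by rewrite correction_z rmorph0.
rewrite (inj_eq (@incl_inj _ _ _ _ vS)) => xy _; rewrite lift_pt_incl correction_incl.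
rewrite rmorph_div ?edge_factor_unit //= !lshiftE; congr (emb _ / emb _).
  rewrite /vertex_factor; case: eqP => _; last by rewrite rmorph1.
  by rewrite rmorphB /= !shift_pt_neq.
rewrite rmorph_prod; apply: eq_bigr => e _.
by rewrite rmorphB /= !shift_pt_neq.
Qed.

(** The relations of u_z hold because [correction] vanishes at z; any other u_x shifts the point of
    x alone, hence neither W_0 nor the images of the parameters. *)
Lemma Psi1_exists : exists Psi : {rmorphism tAloc k E v -> tAloc k void vpt},
  (forall c, Psi (cst c) = cst (twist_loc J1_unit c)) /\
  (forall x, Psi (u x) = cst (correction x) * u (pt (lift_pt x))).
Proof.
apply: twist_exists => [c|x c|x y|x y Fx xy].
- by rewrite /= restrict_C psubst_C.
- elim/(step_split (vS := vS)): x => [|x]; first by rewrite correction_z eqxx.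
  by rewrite /= restrict_l lift_pt_incl shift_J_l.
- elim/(step_split (vS := vS)): x => [|x]; first by rewrite correction_z eqxx.
  move=> _; rewrite [RHS]rmorphD /= J1_hbar J1_w lift_pt_incl rmorphB /= !shift_pt.
  by rewrite -(inj_eq lift_pt_inj) lift_pt_incl [_ == inr None]/= addr0 addrAC.
- exact: shift_correction.
Qed.

Lemma Psi2_exists : exists Psi : {rmorphism tAloc k E v' -> tAloc k void vpt},
  (forall c, Psi (cst c) = cst (twist_loc J_unit c)) /\
  (forall x, Psi (u x) = u (pt (inl x))).
Proof.
have [Psi [Psi_c Psi_u]] : exists Psi : {rmorphism tAloc k E v' -> tAloc k void vpt},
  (forall c, Psi (cst c) = cst (twist_loc J_unit c)) /\
  (forall x, Psi (u x) = cst 1 * u (pt (inl x))).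
  apply: (twist_exists (F := fun=> 1)) => [c|x c _|x y _|x y _ _].
  - exact: psubst_C.
  - exact: shift_J_l.
  - by rewrite rmorphD /= rmorphMn /= J_hbar J_w rmorphB /= !shift_pt [_ == inr _]/= addr0 addrAC.
  - exact: rmorph1.
by exists Psi; split=> // x; rewrite Psi_u rmorph1 mul1r.
Qed.

End Comparison.

(** * Images of the monopole operators in the common localization *)

Section MonopoleComparison.

Context (k : comNzRingType) (I E : finType) (s t : E -> I).
Context (v v' : {ffun I -> nat}) (i0 : I).
Hypothesis vS : forall j, v j = (v' j + (j == i0))%N.

Local Notation incl := (incl vS).
Local Notation z := (zvar vS).
Local Notation rho := (@restrict k I E v v').
Local Notation tL := (tLam k void (vpt E v')).
Local Notation emb := (inloc (vpt E v') : tL -> loc (@dpoly_reg k _ void (vpt E v'))).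
Local Notation J := (psubst (@loc_param_var k I E v')).
Local Notation pt := (@pt I E v').

Lemma prod_step (B : comNzRingType) (h : wvar v -> B) :
  \prod_x h x = (\prod_y h (incl y)) * h z.
Proof.
rewrite (bigD1 z) //= mulrC; congr (_ * _).
transitivity (\prod_(x in incl @: [set: wvar v']) h x).
  apply: eq_bigl => x; elim/(step_split (vS := vS)): x => [|y].
    by rewrite eqxx; apply/esym/imsetP => -[y _ /esym/eqP]; rewrite (negPf (incl_neq _ _)).
  by rewrite incl_neq mem_imset ?inE //; apply: incl_inj.
rewrite big_imset; last by move=> x y _ _; apply: incl_inj.
by apply: eq_bigl => y; rewrite inE.
Qed.

Lemma zvar_notin (G : {set wvar v'}) : z \notin incl @: G.
Proof. by apply/imsetP => -[y _ /esym/eqP]; rewrite (negPf (incl_neq _ _)). Qed.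

Lemma mem_incl (G : {set wvar v'}) y : (incl y \in incl @: G) = (y \in G).
Proof. by rewrite mem_imset //; apply: incl_inj. Qed.

Lemma prod_incl_compl (B : comNzRingType) (G : {set wvar v'}) i (h : wvar v -> B) :
  \prod_(x in ~: (incl @: G) | tag x == i) h x =
  (\prod_(y in ~: G | tag y == i) h (incl y)) * (if i0 == i then h z else 1).
Proof.
rewrite big_mkcond prod_step inE zvar_notin; congr (_ * _).
by rewrite [RHS]big_mkcond; apply: eq_bigr => y _; rewrite !inE mem_incl.
Qed.

Lemma prod_incl (B : comNzRingType) (G : {set wvar v'}) i (h : wvar v -> B) :
  \prod_(x in incl @: G | tag x == i) h x = \prod_(y in G | tag y == i) h (incl y).
Proof.
rewrite big_mkcond prod_step (negPf (zvar_notin G)) mulr1.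
by rewrite [RHS]big_mkcond; apply: eq_bigr => y _; rewrite mem_incl.
Qed.

(** The complement of the enlarged Gamma has z as its only new element, and each edge from tag y to
    [i0] then yields one factor of [edge_factor] at y. *)
Lemma num_restrict (G : {set wvar v'}) :
  J (rho (fmo_num k s t (incl @: G))) = J (fmo_num k s t G) * \prod_(y in G) edge_factor k s t i0 y.
Proof.
rewrite /fmo_num [\prod_(y in G) _]big_mkcond /=.
(* Regroup the edge factors by edge rather than by variable, to match the shape of [fmo_num]. *)
have -> : \prod_y (if y \in G then edge_factor k s t i0 y else 1) =
    \prod_(e : E) \prod_(y in G | tag y == s e)
      (if i0 == t e then w (pt (inr (Some e))) - w (pt (inl y)) else 1 : tL).
  under [RHS]eq_bigr => e _ do rewrite big_mkcond.
  rewrite exchange_big; apply: eq_bigr => y _; case: (y \in G) => /=; last first.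
    by rewrite big1.
  rewrite /edge_factor big_mkcond; apply: eq_bigr => e _.
  by rewrite [s e == _]eq_sym [t e == _]eq_sym; case: (tag y == _).
rewrite !rmorph_prod -big_split; apply: eq_bigr => e _ /=.
rewrite prod_incl !rmorph_prod -big_split; apply: eq_bigr => y _ /=.
rewrite prod_incl_compl !rmorphM !rmorph_prod /=; congr (_ * _).
  apply: eq_bigr => x _; congr J.
  by rewrite !(rmorphD, rmorphN) /= !restrict_incl !restrict_l.
case: eqP => _; last by rewrite !rmorph1.
rewrite !(rmorphD, rmorphN) /= restrict_incl restrict_z !restrict_l.
by rewrite rmorph0 J_w J_theta J_hhbar; ring.
Qed.

Lemma den_restrict (G : {set wvar v'}) :
  J (rho (fmo_den k E (incl @: G))) = J (fmo_den k E G) * \prod_(y in G) vertex_factor k E i0 y.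
Proof.
rewrite /fmo_den big_imset /=; last by move=> x y _ _; apply: incl_inj.
rewrite !rmorph_prod -big_split; apply: eq_bigr => y _ /=.
rewrite prod_incl_compl !rmorphM !rmorph_prod /=; congr (_ * _).
  by apply: eq_bigr => x _; congr J; rewrite rmorphB /= !restrict_incl.
rewrite /vertex_factor eq_sym; case: eqP => _; last by rewrite !rmorph1.
by rewrite !rmorphB /= restrict_incl restrict_z rmorph0 subr0 J_w.
Qed.

(** By [num_restrict] and [den_restrict] the coefficient acquires the product of edge factors over
    vertex factors; the corrections multiply to its inverse. *)
Lemma twist_coef (G : {set wvar v'}) (f : tLam k E v) :
  twist_loc (J1_unit k E vS) (inloc v f * (inloc v (fmo_num k s t (incl @: G)) /
    inloc v (fmo_den k E (incl @: G)))) * \prod_(y in G) correction k s t vS (incl y) =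
  twist_loc (J_unit k E (v' := v'))
    (inloc v' (rho f) * (inloc v' (fmo_num k s t G) / inloc v' (fmo_den k E G))).
Proof.
rewrite [in LHS]rmorphM [in RHS]rmorphM rmorph_div ?fmo_den_unit //.
rewrite [in RHS]rmorph_div ?fmo_den_unit //=.
rewrite !twist_locE -mulrA; congr (_ * _) => /=.
have dU : emb (J (fmo_den k E G)) \is a GRing.unit.
  by rewrite -(twist_locE (J_unit k E (v' := v'))); apply/rmorph_unit/fmo_den_unit.
have pU (h : wvar v' -> tL) : (forall y, emb (h y) \is a GRing.unit) ->
    emb (\prod_(y in G) h y) \is a GRing.unit.
  by move=> hU; rewrite rmorph_prod; apply: rpred_prod => y _; apply: hU.
have eU := pU _ (fun y => edge_factor_unit k s t i0 y).
have wU := pU _ (fun y => vertex_factor_unit k E i0 y).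
under eq_bigr => y _ do rewrite correction_incl.
have -> : \prod_(y in G) (emb (vertex_factor k E i0 y) / emb (edge_factor k s t i0 y)) =
    emb (\prod_(y in G) vertex_factor k E i0 y) / emb (\prod_(y in G) edge_factor k s t i0 y).
  apply: (mulIr eU); rewrite divrK // !rmorph_prod -big_split; apply: eq_bigr => y _ /=.
  by rewrite divrK ?edge_factor_unit.
rewrite num_restrict den_restrict !rmorphM /= invrM // -!mulrA; congr (_ * _).
by rewrite [(emb (J _))^-1 * _]mulrCA mulKr // mulrCA mulrV // mulr1.
Qed.

(** Terms with z in Gamma die with u_z. The other Gamma are the images under [incl] of subsets of
    the smaller set, where [twist_coef] matches the terms. If m is not below v', [zvar_in] puts z in
    every Gamma. *)
Lemma Psi_fmo (Psi1 : {rmorphism tAloc k E v -> tAloc k void (vpt E v')})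
    (Psi2 : {rmorphism tAloc k E v' -> tAloc k void (vpt E v')}) m (f : tLam k E v) :
  (forall c, Psi1 (cst c) = cst (twist_loc (J1_unit k E vS) c)) ->
  (forall x, Psi1 (u x) = cst (correction k s t vS x) * u (pt (lift_pt E vS x))) ->
  (forall c, Psi2 (cst c) = cst (twist_loc (J_unit k E (v' := v')) c)) ->
  (forall x, Psi2 (u x) = u (pt (inl x))) ->
  leqv m v -> f \in Lam k E v m ->
  Psi1 (fmo s t m f) = if leqv m v' then Psi2 (fmo s t m (rho f)) else 0.
Proof.
move=> P1c P1u P2c P2u mv fL.
have P1G (G : {set wvar v}) : Psi1 (\prod_(x in G) u x) =
    cst (\prod_(x in G) correction k s t vS x) *
      umon k void (\sum_(x in G) U_(enum_rank (pt (lift_pt E vS x))))%MM.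
  pose r := [seq x <- index_enum (wvar v) | x \in G].
  have := @prod_twisted k _ void _ _ (fun x => pt (lift_pt E vS x)) (correction k s t vS) r.
  rewrite !big_filter => H; rewrite rmorph_prod; under eq_bigr => x _ do rewrite P1u.
  apply: H; last by rewrite filter_uniq ?index_enum_uniq.
  by move=> x y Fx xy; apply: shift_correction.
have P1z (G : {set wvar v}) : z \in G -> Psi1 (\prod_(x in G) u x) = 0.
  by move=> zG; rewrite P1G (bigD1 z) //= correction_z mul0r rmorph0 mul0r.
rewrite /fmo raddf_sum /= (bigID (fun G : {set wvar v} => z \in G)) /= big1 ?add0r; last first.
  by move=> G /andP[_ zG]; rewrite rmorphM /= P1z ?mulr0.
have [mv'|nmv'] := boolP (leqv m v'); last first.
  apply: big1 => G /andP[Gm]; rewrite (zvar_in vS mv nmv' Gm); by [].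
rewrite raddf_sum /=.
rewrite (reindex_onto (fun G : {set wvar v'} => incl @: G) (fun G => incl @^-1: G)) /=; last first.
  by move=> G /andP[_ zG]; apply: imset_incl_split.
apply: eq_big => [G|G].
  rewrite has_dim_incl zvar_notin andbT /=.
  by rewrite (_ : incl @^-1: _ = G) ?eqxx ?andbT //; apply/setP => y; rewrite inE mem_incl.
rewrite has_dim_incl => /andP[/andP[Gm _] _].
rewrite [Psi1 _]rmorphM [Psi2 _]rmorphM /= P1G P1c P2c.
rewrite -(restrict_at_subset vS mv' fL Gm) -twist_coef.
rewrite [LHS]mulrA -[cst _ * cst _]rmorphM; congr (cst (_ * _) * _).
  by rewrite big_imset //= => x y _ _; apply: incl_inj.
rewrite rmorph_prod; under [RHS]eq_bigr => x _ do rewrite P2u.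
rewrite big_imset /=; last by move=> x y _ _; apply: incl_inj.
have := @prod_u k _ void _ _ (fun x => pt (inl x)) [seq x <- index_enum (wvar v') | x \in G].
by rewrite !big_filter => ->; congr umon; apply: eq_bigr => x _; rewrite lift_pt_incl.
Qed.

End MonopoleComparison.

(** * The restriction map for one removed variable *)

Section CoulombMap.

Context (k : comNzRingType) (I E : finType) (s t : E -> I).

Lemma coulomb_ind (v : {ffun I -> nat}) (T : coulomb k s t v -> Prop) :
  (forall m f (mv : leqv m v) (fL : f \in Lam k E v m), T (FMO s t mv fL)) ->
  T 1 -> (forall a b, T a -> T b -> T (a - b)) -> (forall a b, T a -> T b -> T (a * b)) ->
  forall a, T a.
Proof.
move=> TF T1 TB TM a.
have eqT (b c : coulomb k s t v) : val b = val c -> T b -> T c by move=> /val_inj->.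
(* Induction on [in_coulomb] needs a variable as index, so the underlying element is named x and a
   stays general. *)
have : exists2 x, in_coulomb s t x & val a = x by exists (val a) => //; apply/asboolP; case: a.
case=> x xI; elim: x / xI a => [m f mv fL|||].
- by move=> a aE; apply: eqT (TF m f mv fL).
- by move=> a aE; apply: eqT T1.
- move=> x y xI IHx yI IHy a aE.
  pose b : coulomb k s t v := exist _ x (asboolT xI).
  pose c : coulomb k s t v := exist _ y (asboolT yI).
  by apply: eqT (TB b c (IHx b erefl) (IHy c erefl)).
- move=> x y xI IHx yI IHy a aE.
  pose b : coulomb k s t v := exist _ x (asboolT xI).
  pose c : coulomb k s t v := exist _ y (asboolT yI).
  by apply: eqT (TM b c (IHx b erefl) (IHy c erefl)).
Qed.

(** Comparing underlying elements avoids carrying a proof that the restricted f is invariant. *)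
Definition respects_fmo (v v' : {ffun I -> nat}) (Phi : coulomb k s t v -> coulomb k s t v') :=
  forall m f (mv : leqv m v) (fL : f \in Lam k E v m),
    val (Phi (FMO s t mv fL)) = if leqv m v' then fmo s t m (restrict v' f) else 0.

(** The map is Psi2^-1 Psi1. That Psi1 lands in the image of the smaller algebra is checked on
    generators by [Psi_fmo]; injectivity of Psi2 makes the preimage unique, hence compatible with
    differences and products. *)
Lemma step_map (v v' : {ffun I -> nat}) (i0 : I) :
  (forall j, v j = (v' j + (j == i0))%N) ->
  exists Phi : {rmorphism coulomb k s t v -> coulomb k s t v'}, respects_fmo Phi.
Proof.
move=> vS; have [Psi1 [P1c P1u]] := Psi1_exists k s t vS.
have [Psi2 [P2c P2u]] := Psi2_exists k E v'.
have P2inj : injective Psi2.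
  apply: (twist_inj (@J_inj k I E v') _ P2c P2u).
  by move=> x y /pt_inj[].
have ex (a : coulomb k s t v) : exists b : coulomb k s t v', Psi1 (val a) = Psi2 (val b).
  move: a; apply: coulomb_ind => [m f mv fL||a b [a' Ha] [b' Hb]|a b [a' Ha] [b' Hb]].
  - rewrite /= (Psi_fmo P1c P1u P2c P2u mv fL); case: ifP => mv'.
      by exists (FMO s t mv' (restrict_Lam vS mv' fL)).
    by exists 0; rewrite rmorph0.
  - by exists 1; rewrite !rmorph1.
  - by exists (a' - b'); rewrite !rmorphB /= Ha Hb.
  - by exists (a' * b'); rewrite !rmorphM /= Ha Hb.
pose phi a := projT1 (cid (ex a)).
have phiE a : Psi1 (val a) = Psi2 (val (phi a)) by rewrite /phi; case: (cid _).
have phi_eq a b : Psi1 (val a) = Psi2 (val b) -> phi a = b.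
  by rewrite phiE => /P2inj/val_inj.
have phiZ : zmod_morphism phi.
  by move=> a b; apply: phi_eq; rewrite !rmorphB /= !phiE.
have phiM : monoid_morphism phi.
  split=> [|a b]; apply: phi_eq; first by rewrite !rmorph1.
  by rewrite !rmorphM /= !phiE.
pose Phi : {rmorphism coulomb k s t v -> coulomb k s t v'} := HB.pack phi
  (GRing.isZmodMorphism.Build _ _ phi phiZ) (GRing.isMonoidMorphism.Build _ _ phi phiM).
exists Phi => m f mv fL; apply: P2inj; rewrite -phiE /=.
by rewrite (Psi_fmo P1c P1u P2c P2u mv fL); case: ifP => // _; rewrite rmorph0.
Qed.

End CoulombMap.

(** * Lifting invariant polynomials along the restriction *)

Section LiftInvariants.

Context (k : comNzRingType) (I E : finType) (v v' m : {ffun I -> nat}) (i0 : I).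
Hypothesis vS : forall j, v j = (v' j + (j == i0))%N.
Hypothesis mv' : leqv m v'.

Local Notation incl := (incl vS).
Local Notation z := (zvar vS).
Local Notation rho := (@restrict k I E v v').

Implicit Types (T : {set wvar v}) (sg tau : {perm wvar v}).

Let stab sg :=
  (sg \in Sv v) && (sg @: initial v m == initial v m).

(** The orbit of z under the stabilizer of [initial v m]. *)
Let block : {set wvar v} := [set x | (tag x == i0) && (x \notin initial v m)].

Let z_block : z \in block.
Proof. by rewrite inE eqxx initial_z -leqNgt; apply: (forallP mv'). Qed.

Let stab_mem sg x : stab sg -> (sg x \in initial v m) = (x \in initial v m).
Proof. by case/andP=> _ /eqP sgm; rewrite -{1}sgm mem_imset //; apply: perm_inj. Qed.

Let stab_tag sg x : stab sg -> tag (sg x) = tag x.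
Proof. by case/andP=> /SvP. Qed.

Let stab_block sg x : stab sg -> (sg x \in block) = (x \in block).
Proof. by move=> sgS; rewrite [LHS]inE [RHS]inE stab_mem // stab_tag. Qed.

Let stabP sg : (forall x, tag (sg x) = tag x) ->
  (forall x, (sg x \in initial v m) = (x \in initial v m)) -> stab sg.
Proof.
move=> sgt sgm; apply/andP; split; first exact/SvP.
rewrite eqEcard card_imset ?leqnn ?andbT; last exact: perm_inj.
by apply/subsetP => _ /imsetP[x xm ->]; rewrite sgm.
Qed.

Let stabM sg tau : stab sg -> stab tau -> stab (sg * tau)%g.
Proof.
by move=> sgS tS; apply: stabP => x; rewrite permM ?stab_tag ?stab_mem.
Qed.

Let stabV sg : stab sg -> stab sg^-1%g.
Proof.
move=> sgS; apply: stabP => x; first by rewrite -[in RHS](permKV sg x) (stab_tag _ sgS).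
by rewrite -[in RHS](permKV sg x) (stab_mem _ sgS).
Qed.

Let stab_tperm x y : x \in block -> y \in block -> stab (tperm x y).
Proof.
rewrite [x \in _]inE [y \in _]inE => /andP[/eqP tx xm] /andP[/eqP ty ym].
apply: stabP => a; case: tpermP => [->|->|//]; rewrite ?tx ?ty //.
  by rewrite (negPf xm) (negPf ym).
by rewrite (negPf xm) (negPf ym).
Qed.

Definition kill T : tLam k E v -> tLam k E v :=
  wsubst (fun x => if x \in T then 0 else w x).

HB.instance Definition _ T := GRing.RMorphism.on (kill T).

Let kill_w T x : kill T (w x) = if x \in T then 0 else w x.
Proof. exact: wsubst_w. Qed.

Let kill_sym_act T sg p : sym_act sg (kill T p) = kill (sg @: T) (sym_act sg p).
Proof.
apply: (@wsubst_ext _ _ _ _ _ (sym_act sg \o kill T) (kill (sg @: T) \o sym_act sg))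
  => [c|c|x] /=.
- by rewrite /kill !(sym_act_C, wsubst_C).
- by rewrite /kill !(sym_act_l, wsubst_l).
rewrite sym_act_w !kill_w mem_imset; last exact: perm_inj.
by case: ifP; rewrite ?rmorph0 ?sym_act_w.
Qed.

Let kill_tperm T x y p : x \in T -> y \in T -> kill T (sym_act (tperm x y) p) = kill T p.
Proof.
move=> xT yT.
apply: (@wsubst_ext _ _ _ _ _ (kill T \o sym_act (tperm x y)) (kill T)) => [c|c|a] /=.
- by rewrite sym_act_C.
- by rewrite sym_act_l.
by rewrite sym_act_w !kill_w; case: tpermP => [->|->|//]; rewrite xT yT.
Qed.

Let restrict_kill T p : rho (kill (z |: T) p) = rho (kill T p).
Proof.
apply: (@wsubst_ext _ _ _ _ _ (rho \o kill (z |: T)) (rho \o kill T)) => [c|c|x] /=.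
- by rewrite /kill !wsubst_C.
- by rewrite /kill !wsubst_l.
rewrite !kill_w !inE; case: eqP => //= ->.
by case: ifP; rewrite ?rmorph0 ?restrict_z.
Qed.

Let restrict_kill0 p : rho (kill [set z] p) = rho p.
Proof.
rewrite -[[set z]]setU0 restrict_kill; congr restrict.
rewrite -[RHS]wsubst_id; apply: eq_wsubst => x; by rewrite inE.
Qed.

Section Lift.

Variable f' : tLam k E v'.
Hypothesis f'L : f' \in Lam k E v' m.

Let f0 : tLam k E v := inflate vS f'.

Let f0_fix sg : stab sg -> sg z = z -> sym_act sg f0 = f0.
Proof.
move=> sgS sgz; have [tau sgi] := restrict_perm sgz.
rewrite /f0 (sym_act_inflate _ sgi); move/LamP: f'L => -> //.
  apply/SvP => y; have := stab_tag (incl y) sgS.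
  by rewrite sgi.
apply/eqP; rewrite eqEcard card_imset ?leqnn ?andbT; last exact: perm_inj.
apply/subsetP => _ /imsetP[y ym ->].
by rewrite -(initial_incl vS) -sgi stab_mem // initial_incl.
Qed.

(** With c the transposition of sg z and tau z, sg * c is tau preceded by a permutation fixing z,
    which fixes [f0]. As T contains both swapped variables, c disappears after [kill T]. *)
Let kill_f0 T sg tau : T \subset block -> stab sg -> stab tau ->
  sg z \in T -> tau z \in T -> kill T (sym_act sg f0) = kill T (sym_act tau f0).
Proof.
move=> /subsetP TZ sgS tS sgT tT; pose c := tperm (sg z) (tau z).
have cS : stab c by apply: stab_tperm; apply: TZ.
rewrite -(kill_tperm _ sgT tT) -sym_actM; congr (kill T _).
rewrite -[(sg * _)%g](mulgKV tau) sym_actM f0_fix //.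
  by rewrite stabM ?stabV // stabM.
by rewrite !permM tpermL permK.
Qed.

(** For nonempty T: omit one variable of T from f' and set the others in T to 0. By [pieceE] the
    choice of the omitted one does not matter; the default z occurs for empty T only. *)
Let piece T : tLam k E v :=
  kill T (sym_act (tperm z (odflt z [pick x in T])) f0).

Let pieceE T sg : T \subset block -> stab sg -> sg z \in T ->
  piece T = kill T (sym_act sg f0).
Proof.
move=> TZ sgS sgT; apply: kill_f0 => //; rewrite ?tpermL; case: pickP => [x xT|/(_ (sg z))].
- by rewrite stab_tperm // (subsetP TZ).
- by rewrite sgT.
- by [].
- by rewrite sgT.
Qed.

Let sym_act_piece T sg : T \subset block -> T != set0 -> stab sg ->
  sym_act sg (piece T) = piece (sg @: T).
Proof.
move=> TZ /set0Pn[x xT] sgS; have cS : stab (tperm z x) by rewrite stab_tperm // (subsetP TZ).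
rewrite (pieceE TZ cS) ?tpermL // kill_sym_act -sym_actM; apply/esym/pieceE.
- by apply/subsetP => _ /imsetP[y yT ->]; rewrite stab_block // (subsetP TZ).
- exact: stabM.
- by rewrite permM tpermL imset_f.
Qed.

(** Since [rho] sets w_z = 0 anyway, killing w_z first changes nothing, and an element x of T can
    serve as the omitted variable for both sets. *)
Let restrict_piece T : T \subset block -> T != set0 ->
  rho (piece (z |: T)) = rho (piece T).
Proof.
move=> TZ /set0Pn[x xT]; have cS : stab (tperm z x) by rewrite stab_tperm // (subsetP TZ).
rewrite (pieceE TZ cS) ?tpermL // (pieceE _ cS) ?restrict_kill //.
  by rewrite subUset sub1set z_block.
by rewrite tpermL !inE xT orbT.
Qed.

Let restrict_piece0 : rho (piece [set z]) = f'.
Proof.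
have stab1 : stab 1%g by apply: stabP => x; rewrite perm1.
rewrite (pieceE _ stab1) ?sub1set ?perm1 ?set11 // restrict_kill0.
rewrite f0_fix ?perm1 //; exact: inflateK.
Qed.

(** The stabilizer permutes the pieces, so their alternating sum is invariant. Under [rho] the terms
    of T and of z |: T cancel for each nonempty T without z; the remaining one, T = {z}, gives
    f'. *)
Lemma restrict_Lam_surj : exists2 f, f \in Lam k E v m & rho f = f'.
Proof.
exists (- \sum_(T : {set wvar v} | (T \subset block) && (T != set0)) (-1) ^+ #|T| * piece T).
  apply/LamP => sg sgS /eqP sgm; have sS : stab sg by rewrite /stab sgS.
  rewrite rmorphN rmorph_sum /=; congr (- _).
  rewrite [RHS](reindex_inj (h := fun T : {set wvar v} => sg @: T)) /=; last first.
    by apply: imset_inj; apply: perm_inj.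
  apply: eq_big => [T|T /andP[TZ Tn]].
    congr (_ && _).
      apply/subsetP/subsetP => [H _ /imsetP[x xT ->]|H x xT].
        by rewrite stab_block // H.
      by rewrite -(stab_block x sS) H // imset_f.
    by rewrite imset_eq0.
  rewrite rmorphM rmorphXn rmorphN1 /= sym_act_piece // card_imset //; exact: perm_inj.
rewrite rmorphN rmorph_sum /= (bigID (fun T : {set wvar v} => z \in T)) /=.
(* Subsets containing z are written z |: T with T avoiding z; here T may be empty. *)
rewrite (reindex_onto (fun T : {set wvar v} => z |: T) (fun T => T :\ z)) /=; last first.
  by move=> T /andP[_ zT]; rewrite setD1K.
rewrite (eq_bigl (fun T => (T \subset block) && (z \notin T))) => [|T]; last first.
  rewrite subUset sub1set z_block /= setU11 andbT -andbA; congr (_ && _).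
  rewrite (_ : _ != set0) ?andTb; last by apply/set0Pn; exists z; rewrite setU11.
  apply/eqP/idP => [<-|zT]; first by rewrite !inE eqxx.
  by rewrite setU1K.
(* The empty T stands for {z} and has no partner among the nonempty subsets avoiding z. *)
rewrite (bigD1 set0) /=; last by rewrite sub0set inE.
rewrite (eq_bigl (fun T => (T \subset block) && (T != set0) && (z \notin T))) => [|T]; last first.
  by rewrite andbAC.
rewrite setU0 cards1 expr1 mulN1r rmorphN /= restrict_piece0.
rewrite -addrA -big_split big1 ?addr0 ?opprK //=.
move=> T /andP[/andP[TZ Tn] zT].
rewrite cardsU1 zT add1n exprS mulN1r mulNr rmorphN !rmorphM !rmorphXn !rmorphN1 /=.
by rewrite restrict_piece // addNr.
Qed.

End Lift.
End LiftInvariants.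

(** * Surjectivity and composition of one-variable steps *)

Section RestrictionMap.

Context (k : comNzRingType) (I E : finType) (s t : E -> I).
Implicit Types v : {ffun I -> nat}.

Lemma step_map_surj v v' i0 (Phi : {rmorphism coulomb k s t v -> coulomb k s t v'}) :
  (forall j, v j = (v' j + (j == i0))%N) -> respects_fmo Phi -> forall b, exists a, Phi a = b.
Proof.
move=> vS PhiF; apply: coulomb_ind => [m f mv' fL||a b [a' <-] [b' <-]|a b [a' <-] [b' <-]].
- have [g gL gf] := restrict_Lam_surj vS mv' fL.
  have mv : leqv m v.
    by apply/forallP => i; apply: leq_trans (step_le vS i); apply: (forallP mv').
  by exists (FMO s t mv gL); apply: val_inj; rewrite PhiF mv' gf.
- by exists 1; rewrite rmorph1.
- by exists (a' - b'); rewrite rmorphB.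
- by exists (a' * b'); rewrite rmorphM.
Qed.

Lemma restrict_id v (f : tLam k E v) : restrict v f = f.
Proof.
rewrite -[RHS]wsubst_id; apply: eq_wsubst => x /=.
case: insubP => [r _ rE|]; last by rewrite ltn_ord.
by congr w; apply: wvar_eq.
Qed.

Lemma restrict_trans v v1 v' i0 (f : tLam k E v) :
  (forall j, v j = (v1 j + (j == i0))%N) -> leqv v' v1 ->
  restrict v' (restrict v1 f) = restrict v' f.
Proof.
move=> vS v'v1.
apply: (@wsubst_ext _ _ _ _ _ (@restrict k I E v1 v' \o @restrict k I E v v1)
  (@restrict k I E v v')) => [c|c|x] /=.
- by rewrite /restrict !wsubst_C.
- by rewrite /restrict !wsubst_l.
elim/(step_split (vS := vS)): x => [|y].
  rewrite (restrict_z vS) rmorph0 /restrict wsubst_w; case: insubP => // r /=.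
  by rewrite ltnNge (forallP v'v1).
by rewrite (restrict_incl vS) /restrict !wsubst_w.
Qed.

(** Induction on the number of variables to remove, taking one away at a vertex [i0] where v exceeds
    v'. *)
Lemma restriction_map v v' : leqv v' v ->
  exists Phi : {rmorphism coulomb k s t v -> coulomb k s t v'},
    respects_fmo Phi /\ (forall b, exists a, Phi a = b).
Proof.
move=> v'v; have [n ltn] := ubnP (\sum_i (v i - v' i))%N.
elim: n v v'v ltn => // n IHn v v'v ltn.
have [/forallP eqv|] := boolP [forall i, v i <= v' i]%N.
  have vE : v = v'.
    by apply/ffunP => i; apply/eqP; rewrite eqn_leq eqv (forallP v'v).
  case: v' / vE {v'v ltn eqv IHn}; exists idfun; split=> [m f mv fL|b]; last by exists b.
  by rewrite /= mv restrict_id.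
rewrite negb_forall => /existsP[i0]; rewrite -ltnNge => lti.
pose v1 : {ffun I -> nat} := [ffun i => v i - (i == i0)]%N.
have vS j : v j = (v1 j + (j == i0))%N.
  rewrite ffunE subnK //; case: eqP => // ->; apply: leq_ltn_trans lti; exact: leq0n.
have v'v1 : leqv v' v1.
  apply/forallP => j; rewrite ffunE; case: eqP => [->|_]; last by rewrite subn0 (forallP v'v).
  by rewrite -ltnS subn1 prednK // (leq_ltn_trans _ lti).
have [Phi1 Phi1F] := step_map k s t vS.
have Phi1S := step_map_surj vS Phi1F.
have [|Phi2 [Phi2F Phi2S]] := IHn v1 v'v1.
  rewrite -ltnS; apply: leq_trans ltn; rewrite ltnS.
  rewrite [X in (_ < X)%N](bigD1 i0) // [X in (X < _)%N](bigD1 i0) //=.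
  rewrite (eq_bigr (fun i => v i - v' i)%N) => [|i /negPf ni]; last by rewrite ffunE ni subn0.
  rewrite ltn_add2r ffunE eqxx subn1; apply: ltn_sub2r => //.
  by rewrite ltn_predL; apply: leq_ltn_trans lti.
exists (Phi2 \o Phi1); split=> [m f mv fL|b]; last first.
  by have [a <-] := Phi2S b; have [a' <-] := Phi1S a; exists a'.
rewrite /=; have [mv1|mv1] := boolP (leqv m v1).
  have -> : Phi1 (FMO s t mv fL) = FMO s t mv1 (restrict_Lam vS mv1 fL).
    by apply: val_inj; rewrite Phi1F mv1.
  by rewrite Phi2F (restrict_trans f vS v'v1).
(* If m is not below v1, the first step already kills the operator, and m cannot be below the
   smaller v' either. *)
have -> : Phi1 (FMO s t mv fL) = 0 by apply: val_inj; rewrite Phi1F (negPf mv1).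
rewrite rmorph0; case: ifP => // mv'; case/negP: mv1; apply/forallP => i.
exact: leq_trans (forallP mv' i) (forallP v'v1 i).
Qed.

End RestrictionMap.

(** * Integer degrees of polynomials and of fractions *)

Section IntegerDegrees.

Context (k : comNzRingType) (n : nat).
Implicit Types (p q : {mpoly k[n]}) (d : int).

(** Fractions make negative degrees unavoidable; for d < 0 only the zero polynomial qualifies. *)
Definition zhomog d p := all (fun m => (mdeg m)%:Z == d) (msupp p).

Lemma zhomog_mdeg d p m : zhomog d p -> m \in msupp p -> (mdeg m)%:Z = d.
Proof. by move=> /allP H /H/eqP. Qed.

Lemma zhomogE (d : nat) p : p \is d.-homog <-> zhomog d p.
Proof.
split=> [/dhomogP H|H]; first by apply/allP => m /H /= ->.
by apply/dhomogP => m /(zhomog_mdeg H) [].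
Qed.

Lemma zhomogP d p : zhomog d p -> p = 0 \/ exists2 e : nat, d = e & p \is e.-homog.
Proof.
move=> H; case: d H => d H; first by right; exists d => //; apply/zhomogE.
left; apply/eqP; rewrite -msupp_eq0; case mp: (msupp p) => [//|m r].
by have := @zhomog_mdeg _ _ m H; rewrite mp mem_head => /(_ isT).
Qed.

Lemma zhomog0 d : zhomog d 0.
Proof. by rewrite /zhomog msupp0. Qed.

Lemma zhomogB d p q : zhomog d p -> zhomog d q -> zhomog d (p - q).
Proof.
case: d => d.
  by move=> /zhomogE Hp /zhomogE Hq; apply/zhomogE; apply: dhomogD => //; rewrite dhomogN.
by move=> /zhomogP[->|[]//] /zhomogP[->|[]//]; rewrite subr0; apply: zhomog0.
Qed.

Lemma zhomogM d e p q : zhomog d p -> zhomog e q -> zhomog (d + e) (p * q).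
Proof.
move=> /zhomogP[->|[a -> Hp]]; first by rewrite mul0r => _; apply: zhomog0.
move=> /zhomogP[->|[b -> Hq]]; first by rewrite mulr0; apply: zhomog0.
by apply/zhomogE/dhomogM.
Qed.

(** A monomial of p g has degree dg g, so by injectivity of dg it occurs in no other summand and
    cannot be cancelled. *)
Lemma zhomog_direct (T : eqType) (S : seq T) (dg : T -> int) (p : T -> {mpoly k[n]}) :
  uniq S -> {in S &, injective dg} -> {in S, forall g, zhomog (dg g) (p g)} ->
  \sum_(g <- S) p g = 0 -> {in S, forall g, p g = 0}.
Proof.
move=> uS dI Hp S0 g gS; apply/mpolyP => m; rewrite mcoeff0.
have [mg|/memN_msupp_eq0//] := boolP (m \in msupp (p g)).
have := congr1 (mcoeff m) S0; rewrite mcoeff0 raddf_sum /= (bigD1_seq g) //=.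
rewrite big_seq_cond big1 ?addr0 // => h /andP[hS hg].
apply: memN_msupp_eq0; apply: contraNN hg => mh; apply/eqP/dI => //.
by rewrite -(zhomog_mdeg (Hp _ hS) mh) (zhomog_mdeg (Hp _ gS) mg).
Qed.

End IntegerDegrees.

Section DegreePreserving.

Context (k : comNzRingType) (I E : finType) (v v' : {ffun I -> nat}).
Variable h : wvar v -> tLam k E v'.
Hypothesis h_homog : forall x, h x \is 1.-homog.

Let wsubst_X m : wsubst h 'X_[m] \is (mdeg m).-homog.
Proof.
rewrite mpolyXE_id mdegE rmorph_prod; apply: (big_ind2 (fun p d => p \is d.-homog)).
- exact: dhomog1.
- by move=> p d q e; apply: dhomogM.
move=> i _; rewrite rmorphXn -{2}[m i]mul1n /=; apply: dhomogMn.
rewrite -[i]enum_valK; have := wsubst_vX h (enum_val i); rewrite /vX => ->.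
by case: (enum_val i) => [c|x] /=; [rewrite dhomogX /= mdeg1 | apply: h_homog].
Qed.

(** Substituting linear forms turns a monomial into a homogeneous polynomial of the same degree, so
    homogeneous components are respected. *)
Lemma wsubst_pihomog d p :
  wsubst h (pihomog mdeg d p) = pihomog mdeg d (wsubst h p).
Proof.
move: p; apply: mpoly_lin_ind => [|p q Hp Hq|c m].
- by rewrite !raddf0.
- by rewrite !raddfD /= Hp Hq.
have hZ e q : wsubst h (e *: q) = e *: wsubst h q.
  by rewrite -!mul_mpolyC rmorphM /= wsubst_C.
rewrite !linearZ /= !hZ linearZ /= pihomogX; case: eqP => [md|/eqP md].
  by rewrite pihomog_dE // -md.
by rewrite rmorph0 (pihomog_ne0 md) ?wsubst_X.
Qed.

Lemma wsubst_homog d p : p \is d.-homog -> wsubst h p \is d.-homog.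
Proof. by rewrite !homog_piE -wsubst_pihomog => /eqP->. Qed.

Lemma wsubst_zhomog d p : zhomog d p -> zhomog d (wsubst h p).
Proof.
move=> /zhomogP[->|[e -> He]]; first by rewrite rmorph0; apply: zhomog0.
exact/zhomogE/wsubst_homog.
Qed.

End DegreePreserving.

Section LocalizedDegrees.

Context (k : comNzRingType) (I E : finType) (v : {ffun I -> nat}).
Local Notation tLamloc := (loc (@dpoly_reg k I E v)).
Local Notation lfrac := (@lfrac _ _ _ (@dpoly_reg k I E v)).
Local Notation denom := (@denom _ _ (@dpoly k I E v)).

Lemma w_homog (x : wvar v) : (w x : tLam k E v) \is 1.-homog.
Proof. by rewrite dhomogX /= mdeg1. Qed.

Lemma vX_homog (x : var E v) : (vX x : tLam k E v) \is 1.-homog.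
Proof. by rewrite dhomogX /= mdeg1. Qed.

Lemma hbar_homog : (hbar : tLam k E v) \is 1.-homog.
Proof. by rewrite /hbar -scaler_nat; apply/dhomogZ/vX_homog. Qed.

Lemma dpoly_homog d : dpoly k E (v := v) d \is 1.-homog.
Proof.
rewrite /dpoly -scaler_int; apply: dhomogD; last exact/dhomogZ/hbar_homog.
by apply: dhomogD; rewrite ?dhomogN w_homog.
Qed.

Lemma denom_homog ds : denom ds \is (size ds).-homog.
Proof.
elim: ds => [|d ds IHds]; first by rewrite denom_nil dhomog1.
by rewrite /denom big_cons -[size _]add1n; apply: dhomogM (dpoly_homog d) IHds.
Qed.

Lemma denom_zhomog ds : zhomog (size ds) (denom ds).
Proof. exact/zhomogE/denom_homog. Qed.

(** One representation with homogeneous numerator is enough; its denominator is a product of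
    [size ds] linear forms. *)
Definition lhomog (d : int) (x : tLamloc) :=
  exists n ds, x = lfrac n ds /\ zhomog (d + (size ds)%:Z) n.

Lemma lfracM a ds b es : lfrac a ds * lfrac b es = lfrac (a * b) (ds ++ es).
Proof.
have U := toloc_denom_unit (@dpoly_reg k I E v).
by rewrite !lfracE denom_cat !rmorphM invrM //= [_^-1 * _]mulrC mulrACA.
Qed.

Lemma lfracB a b ds : lfrac a ds - lfrac b ds = lfrac (a - b) ds.
Proof. by rewrite !lfracE rmorphB mulrBl. Qed.

Lemma lfrac0 ds : lfrac 0 ds = 0.
Proof. by rewrite lfracE rmorph0 mul0r. Qed.

Lemma lfrac_expandr a ds es : lfrac a ds = lfrac (a * denom es) (ds ++ es).
Proof. by apply/lfrac_eq; rewrite denom_cat -mulrA [denom ds * _]mulrC. Qed.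

Lemma lfrac_expandl a ds es : lfrac a ds = lfrac (a * denom es) (es ++ ds).
Proof. by apply/lfrac_eq; rewrite denom_cat mulrA. Qed.

Lemma lhomog0 d : lhomog d 0.
Proof. by exists 0, [::]; rewrite lfrac0; split=> //; apply: zhomog0. Qed.

Lemma lhomog_inloc d p : zhomog d p -> lhomog d (inloc v p).
Proof. by exists p, [::]; rewrite addr0. Qed.

Lemma lhomog1 : lhomog 0 1.
Proof. by rewrite -(rmorph1 (inloc v)); apply/lhomog_inloc/zhomogE/dhomog1. Qed.

Lemma lhomogB d x y : lhomog d x -> lhomog d y -> lhomog d (x - y).
Proof.
move=> [a [ds [-> Ha]]] [b [es [-> Hb]]].
rewrite (lfrac_expandr a ds es) (lfrac_expandl b es ds) lfracB.
exists (a * denom es - b * denom ds), (ds ++ es); split=> //.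
rewrite size_cat PoszD addrA; apply: zhomogB.
  exact: zhomogM Ha (denom_zhomog es).
by rewrite addrAC; apply: zhomogM Hb (denom_zhomog _).
Qed.

Lemma lhomogM d e x y : lhomog d x -> lhomog e y -> lhomog (d + e) (x * y).
Proof.
move=> [a [ds [-> Ha]]] [b [es [-> Hb]]]; rewrite lfracM.
exists (a * b), (ds ++ es); split=> //.
by rewrite size_cat PoszD addrACA; apply: zhomogM.
Qed.

Lemma common_denominator (T : eqType) (S : seq T) (dg : T -> int) (x : T -> tLamloc) :
  {in S, forall g, lhomog (dg g) (x g)} ->
  exists ds (a : T -> tLam k E v), {in S, forall g,
    x g = lfrac (a g) ds /\ zhomog (dg g + (size ds)%:Z) (a g)}.
Proof.
elim: S => [|g S IHS] Hx; first by exists [::], (fun=> 0).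
have [|ds [a Ha]] := IHS; first by move=> h hS; apply: Hx; rewrite inE hS orbT.
have [b [es [xg Hb]]] := Hx g (mem_head _ _).
exists (ds ++ es), (fun h => if h == g then b * denom ds else a h * denom es) => h.
rewrite inE size_cat PoszD addrA; case: eqP => [-> _|_ /= /Ha[xh Hh]].
  rewrite xg -lfrac_expandl; split=> //.
  by rewrite addrAC; apply: zhomogM Hb (denom_zhomog _).
by rewrite xh -lfrac_expandr; split=> //; apply: zhomogM Hh (denom_zhomog _).
Qed.

(** Over a common denominator this is a relation between numerators whose degrees are all raised by
    the same amount, so [zhomog_direct] applies. *)
Lemma lhomog_direct (T : eqType) (S : seq T) (dg : T -> int) (x : T -> tLamloc) :
  uniq S -> {in S &, injective dg} -> {in S, forall g, lhomog (dg g) (x g)} ->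
  \sum_(g <- S) x g = 0 -> {in S, forall g, x g = 0}.
Proof.
move=> uS dI /common_denominator[ds [a Ha]] S0.
have sa : \sum_(g <- S) a g = 0.
  apply: (@toloc_inj _ _ _ (@dpoly_reg k I E v)).
  have U := toloc_denom_unit (@dpoly_reg k I E v) ds.
  rewrite rmorph0 -[LHS](divrK U) -lfracE (_ : lfrac _ ds = 0) ?mul0r // -S0.
  rewrite lfracE rmorph_sum mulr_suml big_seq [in RHS]big_seq; apply: eq_bigr => g gS.
  by have [-> _] := Ha g gS; rewrite lfracE.
move=> g gS; have [-> _] := Ha g gS.
rewrite (zhomog_direct (dg := fun g => dg g + (size ds)%:Z) uS _ _ sa gS) ?lfrac0 //.
  by move=> h h' hS h'S /addIr; apply: dI.
by move=> h hS; have [] := Ha h hS.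
Qed.

Definition shift_dfactor (a : 'X_{1..#|wvar v|}) (d : dfactor v) : dfactor v :=
  exist _ ((val d).1.1, (val d).1.2,
    ((val d).2 + (a (enum_rank (val d).1.1))%:Z - (a (enum_rank (val d).1.2))%:Z)%R) (valP d).

Lemma shift_dpoly a d : shift a (dpoly k E d) = dpoly k E (shift_dfactor a d).
Proof.
rewrite /dpoly /= rmorphD rmorphB rmorphMz /= shift_hbar !shift_w.
rewrite !mulrzDr mulrNz -!pmulrn; ring.
Qed.

Lemma lshift_frac a n ds :
  Defs.lshift a (lfrac n ds) = lfrac (shift a n) (map (shift_dfactor a) ds).
Proof.
have U := toloc_denom_unit (@dpoly_reg k I E v).
rewrite !lfracE rmorph_div ?U //= !lshiftE; congr (_ / inloc v _).
rewrite /denom rmorph_prod big_map; apply: eq_bigr => d _; exact: shift_dpoly.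
Qed.

(** A shift sends each denominator factor to another one, keeping their number, and acts on the
    numerator by linear substitution, since hbar has degree 1. *)
Lemma lhomog_shift a d x : lhomog d x -> lhomog d (Defs.lshift a x).
Proof.
move=> [n [ds [-> Hn]]]; exists (shift a n), (map (shift_dfactor a) ds).
rewrite lshift_frac size_map; split=> //; apply: wsubst_zhomog Hn => y.
by rewrite -scaler_nat; apply: dhomogD; [apply: w_homog | apply/dhomogZ/hbar_homog].
Qed.

Definition lhomog_unit d x := [/\ x \is a GRing.unit, lhomog d x & lhomog (- d) x^-1].

Lemma lhomog_unitM d e x y : lhomog_unit d x -> lhomog_unit e y -> lhomog_unit (d + e) (x * y).
Proof.
move=> [xU xd xi] [yU ye yi]; split; first by rewrite unitrMl.
  exact: lhomogM.
by rewrite invrM // mulrC opprD; apply: lhomogM.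
Qed.

Lemma lhomog_unit1 : lhomog_unit 0 1.
Proof. by rewrite /lhomog_unit invr1 oppr0 unitr1; split=> //; apply: lhomog1. Qed.

Lemma lhomog_unit_dpoly d : lhomog_unit 1 (inloc v (dpoly k E d)).
Proof.
split; first exact: toloc_den_unit.
  exact/lhomog_inloc/zhomogE/dpoly_homog.
exists 1, [:: d]; rewrite lfracE rmorph1 mul1r /denom big_seq1; split=> //.
exact/zhomogE/dhomog1.
Qed.

End LocalizedDegrees.

(** * The bigrading on difference operators *)

Section TwistedDegrees.

Context (k : comNzRingType) (I E : finType) (s t : E -> I) (v : {ffun I -> nat}).
Local Notation tLamloc := (loc (@dpoly_reg k I E v)).
Local Notation deg := ({ffun I -> int} * int)%type.
Implicit Types (g h : deg) (c d : tLamloc) (a b : 'X_{1..#|wvar v|}) (x y : tAloc k E v).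

Definition udeg (x : wvar v) : deg :=
  ([ffun i => (tag x == i)%:Z],
   (v (tag x))%:Z - \sum_(e | s e == tag x) (v (t e))%:Z).

Definition mondeg a : deg := \sum_j udeg (enum_val j) *+ a j.

Lemma mondegD a b : mondeg (a + b)%MM = mondeg a + mondeg b.
Proof. by rewrite -big_split; apply: eq_bigr => j _; rewrite mnmDE mulrnDr. Qed.

Lemma mondeg0 : mondeg 0%MM = 0.
Proof. by rewrite /mondeg big1 // => j _; rewrite mnm0E. Qed.

Lemma mondegU (x : wvar v) : mondeg U_(enum_rank x) = udeg x.
Proof.
rewrite /mondeg (bigD1 (enum_rank x)) //= mnm1E eqxx mulr1n enum_rankK big1 ?addr0 //.
by move=> j /negPf jx; rewrite mnm1E eq_sym jx mulr0n.
Qed.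

(** Coefficients lie in degree 0 for the Z^I-component, so any other first component allows only
    0. *)
Definition glhomog g c := lhomog g.2 c /\ (g.1 != 0 -> c = 0).

Lemma glhomog0 g : glhomog g 0.
Proof. by split=> //; apply: lhomog0. Qed.

Lemma glhomogB g c d : glhomog g c -> glhomog g d -> glhomog g (c - d).
Proof.
move=> [gc c0] [gd d0]; split; first exact: lhomogB.
by move=> g0; rewrite c0 ?d0 ?subr0.
Qed.

Lemma glhomogM g h c d : glhomog g c -> glhomog h d -> glhomog (g + h) (c * d).
Proof.
move=> [gc c0] [gd d0]; split; first exact: lhomogM.
have [g0|/c0->] := eqVneq g.1 0; last by rewrite mul0r.
by rewrite /= g0 add0r => /d0->; rewrite mulr0.
Qed.

Lemma glhomog_shift a g c : glhomog g c -> glhomog g (Defs.lshift a c).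
Proof.
move=> [gc c0]; split; first exact: lhomog_shift.
by move=> /c0->; rewrite rmorph0.
Qed.

(** The u^a form a basis, so homogeneity is tested on coefficients, from which the degree of u^a is
    subtracted. *)
Definition thomog g x :=
  forall a, glhomog (g - mondeg a) ((x : {mpoly tLamloc[#|wvar v|]})@_a).

Lemma thomog0 g : thomog g 0.
Proof. by move=> a; rewrite mcoeff0; apply: glhomog0. Qed.

Lemma thomogB g x y : thomog g x -> thomog g y -> thomog g (x - y).
Proof. by move=> gx gy a; rewrite mcoeffB; apply: glhomogB. Qed.

Lemma thomogD g x y : thomog g x -> thomog g y -> thomog g (x + y).
Proof.
move=> gx gy; rewrite -[y]opprK -[- y]sub0r; apply: thomogB => //.
by apply: thomogB => //; apply: thomog0.
Qed.

Lemma thomog_sum (T : Type) (r : seq T) (P : pred T) (F : T -> tAloc k E v) g :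
  (forall i, P i -> thomog g (F i)) -> thomog g (\sum_(i <- r | P i) F i).
Proof.
by move=> gF; apply: big_ind => //; [apply: thomog0 | move=> x y; apply: thomogD].
Qed.

Lemma thomog_umon g c a : glhomog (g - mondeg a) c -> thomog g (cst c * umon k E a).
Proof.
move=> gc b; rewrite cst_umon mcoeffZ mcoeffX; case: eqP => [<-|_].
  by rewrite mulr1.
by rewrite mulr0; apply: glhomog0.
Qed.

Lemma thomog1 : thomog 0 1.
Proof.
rewrite -[1]mulr1 -[X in X * _](rmorph1 (@cst k I E v)) -umon0; apply: thomog_umon.
by rewrite mondeg0 subr0; split; [apply: lhomog1 | rewrite eqxx].
Qed.

(** Moving u^a past a coefficient shifts the latter, and shifts preserve degrees. *)
Lemma thomogM g h x y : thomog g x -> thomog h y -> thomog (g + h) (x * y).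
Proof.
move=> gx hy; rewrite (tAloc_basis x) (tAloc_basis y) mulr_suml; apply: thomog_sum => a _.
rewrite mulr_sumr; apply: thomog_sum => b _.
rewrite -mulrA [umon _ _ a * _]mulrA umon_cst -mulrA -umonD mulrA -rmorphM.
apply: thomog_umon; rewrite mondegD opprD addrACA; apply: glhomogM; first exact: gx.
exact/glhomog_shift/hy.
Qed.

(** Look at the coefficients of one u^a. Only degrees whose Z^I-component is that of u^a contribute,
    and these are told apart by their integer component, so [lhomog_direct] applies. *)
Lemma thomog_direct (S : seq deg) (x : deg -> tAloc k E v) : uniq S ->
  (forall g, thomog g (x g)) -> \sum_(g <- S) x g = 0 -> {in S, forall g, x g = 0}.
Proof.
move=> uS gx S0 g gS; apply/mpolyP => a; rewrite mcoeff0.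
have [ga|] := eqVneq (g - mondeg a).1 0; last by have [_ H] := gx g a; apply: H.
pose S' := [seq h <- S | (h - mondeg a).1 == 0].
apply: (lhomog_direct (S := S') (dg := fun h => (h - mondeg a).2)
  (x := fun h => (x h : {mpoly tLamloc[#|wvar v|]})@_a)).
- exact: filter_uniq.
- move=> h h'; rewrite !mem_filter => /andP[/eqP h0 _] /andP[/eqP h'0 _] hh'.
  by apply: (addIr (- mondeg a)); rewrite [LHS]surjective_pairing h0 hh' -h'0 -surjective_pairing.
- by move=> h _; case: (gx h a).
- transitivity (\sum_(h <- S) (x h : {mpoly tLamloc[#|wvar v|]})@_a); last first.
    by have := congr1 (mcoeff a) S0; rewrite mcoeff0 raddf_sum.
  rewrite big_filter [RHS](bigID (fun h => (h - mondeg a).1 == 0)) /=.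
  rewrite [X in _ = _ + X]big1 ?addr0 // => h hn.
  by have [_ H] := gx h a; apply: H.
- by rewrite mem_filter ga eqxx.
Qed.

End TwistedDegrees.

(** * The degree of a monopole operator *)

Section MonopoleDegree.

Context (k : comNzRingType) (I E : finType) (s t : E -> I) (v m : {ffun I -> nat}).
Implicit Types (G : {set wvar v}).

Lemma lhomog_prod (J : Type) (r : seq J) (P : pred J) (dg : J -> int)
    (x : J -> loc (@dpoly_reg k I E v)) :
  (forall i, P i -> lhomog (dg i) (x i)) ->
  lhomog (\sum_(i <- r | P i) dg i) (\prod_(i <- r | P i) x i).
Proof.
move=> H; apply: (big_ind2 (fun x d => lhomog d x)) => //; first exact: lhomog1.
by move=> a d b e; apply: lhomogM.
Qed.

Lemma lhomog_unit_prod (J : Type) (r : seq J) (P : pred J) (dg : J -> int)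
    (x : J -> loc (@dpoly_reg k I E v)) :
  (forall i, P i -> lhomog_unit (dg i) (x i)) ->
  lhomog_unit (\sum_(i <- r | P i) dg i) (\prod_(i <- r | P i) x i).
Proof.
move=> H; apply: (big_ind2 (fun x d => lhomog_unit d x)) => //; first exact: lhomog_unit1.
by move=> a d b e; apply: lhomog_unitM.
Qed.

Lemma at_subset_homog d (f : tLam k E v) G : f \is d.-homog -> at_subset m f G \is d.-homog.
Proof. by apply: wsubst_homog => x; apply: w_homog. Qed.

Lemma sum_fiber G i : has_dim m G -> \sum_(x in G | tag x == i) 1 = (m i)%:Z :> int.
Proof.
move=> /forallP/(_ i)/eqP <-; rewrite -sum1_card -natz natr_sum.
by apply: eq_bigl => x; rewrite inE.
Qed.

Lemma sum_fiberC G i : has_dim m G -> \sum_(x in ~: G | tag x == i) 1 = (v i)%:Z - (m i)%:Z :> int.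
Proof.
move=> Gm; suff -> : (v i)%:Z = (m i)%:Z + \sum_(x in ~: G | tag x == i) 1 by rewrite addrC addKr.
rewrite -{1}(card_fiber v i) -sum1_card -natz natr_sum -(sum_fiber i Gm).
rewrite (bigID (fun x => x \in G)) /=; congr (_ + _); apply: eq_bigl => x; by rewrite !inE andbC.
Qed.

Lemma num_lhomog G : has_dim m G -> lhomog
  (\sum_(e : E) \sum_(x in G | tag x == s e) ((v (t e))%:Z - (m (t e))%:Z))
  (inloc v (fmo_num k s t G)).
Proof.
move=> Gm; rewrite /fmo_num rmorph_prod; apply: lhomog_prod => e _.
rewrite rmorph_prod; apply: lhomog_prod => x _.
rewrite rmorph_prod -(sum_fiberC _ Gm); apply: lhomog_prod => y _.
apply/lhomog_inloc/zhomogE; apply: dhomogD; last by rewrite dhomogN vX_homog.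
apply: dhomogD; last exact: vX_homog.
by apply: dhomogD; rewrite ?dhomogN w_homog.
Qed.

Lemma den_lhomog G : has_dim m G -> lhomog_unit
  (\sum_(x in G) ((v (tag x))%:Z - (m (tag x))%:Z)) (inloc v (fmo_den k E G)).
Proof.
move=> Gm; rewrite /fmo_den rmorph_prod; apply: lhomog_unit_prod => x xG.
rewrite rmorph_prod -(sum_fiberC _ Gm); apply: lhomog_unit_prod => y /andP[yG /eqP txy].
have Hd : (tag x == tag y) && (x != y).
  by rewrite txy eqxx; apply: contraTneq yG => <-; rewrite inE xG.
have := lhomog_unit_dpoly k E (exist _ (x, y, 0) Hd : dfactor v).
by rewrite /dpoly /= mulr0z addr0.
Qed.

Lemma sum_over_fibers G (h : I -> int) : has_dim m G ->
  \sum_(x in G) h (tag x) = \sum_i h i * (m i)%:Z.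
Proof.
move=> Gm; rewrite (partition_big (fun x : wvar v => tag x) predT) //=.
apply: eq_bigr => i _; rewrite -(sum_fiber i Gm) mulr_sumr.
by apply: eq_bigr => x /andP[_ /eqP->]; rewrite mulr1.
Qed.

(** Grouping edges by their endpoints turns the sum over E into one over pairs of vertices, and the
    two edge terms of the Cartan matrix agree after exchanging i and j. *)
Lemma form_zvec : half_form s t (zvec m) =
  \sum_i (m i)%:Z * (m i)%:Z - \sum_e (m (s e))%:Z * (m (t e))%:Z.
Proof.
have two : (2 : int) != 0 by [].
(* Doubling both sides removes the integer division. *)
apply: (mulfI two); rewrite half_formE /form.
pose N (i j : I) : int := (nedges s t i j)%:Z * (m i)%:Z * (m j)%:Z.
have EN : \sum_e (m (s e))%:Z * (m (t e))%:Z = \sum_i \sum_j N i j.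
  rewrite (partition_big s predT) //=; apply: eq_bigr => i _.
  rewrite (partition_big t predT) //=; apply: eq_bigr => j _.
  rewrite /N /nedges -sum1_card -natz natr_sum !mulr_suml.
  apply: eq_big => [e|e]; first by rewrite inE.
  by move=> /andP[/eqP-> /eqP->]; rewrite mul1r.
transitivity (\sum_i \sum_j (2 * ((i == j)%:Z * (m i)%:Z * (m j)%:Z) - N i j - N j i)).
  apply: eq_bigr => i _; apply: eq_bigr => j _.
  by rewrite !ffunE /cartan /N; ring.
transitivity (\sum_i \sum_j 2 * ((i == j)%:Z * (m i)%:Z * (m j)%:Z) -
    \sum_i \sum_j N i j - \sum_i \sum_j N j i).
  rewrite -!sumrB; apply: eq_bigr => i _; rewrite -!sumrB; apply: eq_bigr => j _.
  by [].
rewrite [\sum_i \sum_j N j i]exchange_big -EN mulrBr mulr_sumr.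
have -> : \sum_i \sum_j 2 * ((i == j)%:Z * (m i)%:Z * (m j)%:Z) =
    \sum_i 2 * ((m i)%:Z * (m i)%:Z).
  apply: eq_bigr => i _; rewrite (bigD1 i) //= eqxx mul1r big1 ?addr0 // => j.
  by rewrite eq_sym => /negPf->; rewrite !mul0r mulr0.
ring.
Qed.

(** The three sums are the degrees of numerator, denominator and u^Gamma. In terms of m, the
    contributions v_i m_i and m_(s e) v_(t e) each occur with both signs, leaving the expression of
    [form_zvec]. *)
Lemma fmo_degree G : has_dim m G ->
  (\sum_(e : E) \sum_(x in G | tag x == s e) ((v (t e))%:Z - (m (t e))%:Z) -
   \sum_(x in G) ((v (tag x))%:Z - (m (tag x))%:Z)) +
  \sum_(x in G) ((v (tag x))%:Z - \sum_(e | s e == tag x) (v (t e))%:Z) =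
  half_form s t (zvec m) :> int.
Proof.
move=> Gm; rewrite form_zvec.
have -> : \sum_(e : E) \sum_(x in G | tag x == s e) ((v (t e))%:Z - (m (t e))%:Z) =
    \sum_e (m (s e))%:Z * ((v (t e))%:Z - (m (t e))%:Z).
  apply: eq_bigr => e _; rewrite -(sum_fiber (s e) Gm) mulr_suml.
  by apply: eq_bigr => x _; rewrite mul1r.
rewrite (sum_over_fibers (fun i => (v i)%:Z - (m i)%:Z) Gm).
rewrite (sum_over_fibers (fun i => (v i)%:Z - \sum_(e | s e == i) (v (t e))%:Z) Gm).
have -> : \sum_i ((v i)%:Z - \sum_(e | s e == i) (v (t e))%:Z) * (m i)%:Z =
    \sum_i (v i)%:Z * (m i)%:Z - \sum_e (m (s e))%:Z * (v (t e))%:Z.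
  rewrite [in RHS](partition_big s predT) //= -sumrB; apply: eq_bigr => i _.
  rewrite mulrBl; congr (_ - _); rewrite mulr_suml; apply: eq_bigr => e /eqP->.
  by rewrite mulrC.
under eq_bigr => e _ do rewrite mulrBr.
under [X in _ - X + _]eq_bigr => i _ do rewrite mulrBl.
rewrite !sumrB; ring.
Qed.

Lemma mondeg_subset G : has_dim m G ->
  mondeg s t (\sum_(x in G) U_(enum_rank x))%MM =
  (zvec m, \sum_(x in G) ((v (tag x))%:Z - \sum_(e | s e == tag x) (v (t e))%:Z)).
Proof.
move=> Gm.
have -> : mondeg s t (\sum_(x in G) U_(enum_rank x))%MM = \sum_(x in G) udeg s t x.
  apply: (big_ind2 (fun a g => mondeg s t a = g)); first exact: mondeg0.
    by move=> a g b h <- <-; apply: mondegD.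
  by move=> x _; apply: mondegU.
rewrite [LHS]surjective_pairing (big_morph fst (id1 := 0) (op1 := +%R)) //.
rewrite (big_morph snd (id1 := 0) (op1 := +%R)) //; congr (_, _).
apply/ffunP => i; rewrite sum_ffunE !ffunE -(sum_fiber i Gm) big_mkcondr.
by apply: eq_bigr => x _; rewrite ffunE; case: eqP.
Qed.

Lemma fmo_thomog d (f : tLam k E v) : f \is d.-homog ->
  thomog s t (zvec m, d%:Z + half_form s t (zvec m)) (fmo s t m f).
Proof.
move=> fd; apply: thomog_sum => G Gm.
have := @prod_u k I E _ v id [seq x <- index_enum (wvar v) | x \in G].
rewrite !big_filter => ->; apply: thomog_umon; rewrite mondeg_subset //.
split; last by rewrite /= subrr eqxx.
rewrite /= -(fmo_degree Gm) addrA addrK; apply: lhomogM.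
  exact/lhomog_inloc/zhomogE/at_subset_homog.
by apply: lhomogM; [apply: num_lhomog | case: (den_lhomog Gm)].
Qed.

End MonopoleDegree.

(** * Decomposition into homogeneous components *)

Section SpannedByHomogeneous.

Context (G : zmodType) (A : nzRingType) (H : G -> A -> Prop).
Hypotheses (H0 : forall g, H g 0) (HB : forall g x y, H g x -> H g y -> H g (x - y)).
Hypotheses (H1 : H 0 1) (HM : forall g h x y, H g x -> H h y -> H (g + h) (x * y)).

Definition spanned (a : A) := exists2 l : seq (G * A),
  {in l, forall p, H p.1 p.2} & a = \sum_(p <- l) p.2.

Lemma spanned1 : spanned 1.
Proof. by exists [:: (0, 1)]; rewrite ?big_seq1 // => p; rewrite inE => /eqP->. Qed.

Lemma spannedB a b : spanned a -> spanned b -> spanned (a - b).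
Proof.
move=> [l lH ->] [r rH ->]; exists (l ++ [seq (p.1, - p.2) | p <- r]) => [p|].
  rewrite mem_cat => /orP[/lH//|/mapP[q /rH qH ->]].
  by rewrite -sub0r; apply: HB.
by rewrite big_cat big_map sumrN.
Qed.

Lemma spannedM a b : spanned a -> spanned b -> spanned (a * b).
Proof.
move=> [l lH ->] [r rH ->].
exists [seq (p.1 + q.1, p.2 * q.2) | p <- l, q <- r] => [p|].
  by move=> /allpairsP[[p' q'] [/lH p'H /rH q'H ->]]; apply: HM.
rewrite big_allpairs_dep mulr_suml; apply: eq_bigr => p _.
by rewrite mulr_sumr.
Qed.

(** Summands of equal degree are collected. Including g0 in S makes the component of degree g0
    available even when no summand has that degree. *)
Lemma spanned_decomp a g0 : spanned a -> exists (S : seq G) (c : G -> A),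
  [/\ uniq S, g0 \in S, forall g, H g (c g) & a = \sum_(g <- S) c g].
Proof.
move=> [l lH ->]; have [S SE uS] : exists2 S, S =i g0 :: map fst l & uniq S.
  by exists (undup (g0 :: map fst l)); [apply: mem_undup | apply: undup_uniq].
exists S, (fun g => \sum_(p <- l | p.1 == g) p.2).
split; [by [] | by rewrite SE mem_head | |].
  move=> g; rewrite big_seq_cond; apply: big_ind => //.
    by move=> x y Hx Hy; rewrite -[y]opprK -[- y]sub0r; apply/HB/HB.
  by move=> p /andP[/lH Hp /eqP<-].
rewrite (exchange_big_dep predT) //= big_seq [RHS]big_seq; apply: eq_bigr => p pl.
have pS : p.1 \in S by rewrite SE inE map_f ?orbT.
rewrite [RHS]big_mkcond [RHS](bigD1_seq p.1) //= eqxx big1 ?addr0 // => g.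
by rewrite eq_sym => /negPf->.
Qed.

End SpannedByHomogeneous.

(** * The grading of A(v) and the gradedness of the restriction maps *)

Section CoulombGrading.

Context (k : comNzRingType) (I E : finType) (s t : E -> I).
Local Notation deg := ({ffun I -> int} * int)%type.

Section FmoPieces.

Context (v m : {ffun I -> nat}).

Lemma fmo_is_zmod_morphism : zmod_morphism (@fmo k I E s t v m).
Proof.
move=> f g; rewrite /fmo -sumrB; apply: eq_bigr => G _.
by rewrite /at_subset rmorphB /= rmorphB mulrBl rmorphB mulrBl.
Qed.

HB.instance Definition _ := GRing.isZmodMorphism.Build _ _ (@fmo k I E s t v m)
  fmo_is_zmod_morphism.

Lemma pihomog_Lam d f : f \in Lam k E v m -> pihomog mdeg d f \in Lam k E v m.
Proof.
move=> /LamP fL; apply/LamP => sg sgS sgm.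
by rewrite /sym_act wsubst_pihomog => [|x]; [congr pihomog; apply: fL | apply: w_homog].
Qed.

End FmoPieces.

Definition cgrade (v : {ffun I -> nat}) (g : deg) (a : coulomb k s t v) := thomog s t g (val a).

Lemma cgrade0 v g : cgrade (v := v) g 0.
Proof. exact: thomog0. Qed.

Lemma cgradeB v g (x y : coulomb k s t v) : cgrade g x -> cgrade g y -> cgrade g (x - y).
Proof. exact: thomogB. Qed.

Lemma cgrade1 v : cgrade (v := v) 0 1.
Proof. exact: thomog1. Qed.

Lemma cgradeM v g h (x y : coulomb k s t v) :
  cgrade g x -> cgrade h y -> cgrade (g + h) (x * y).
Proof. exact: thomogM. Qed.

Lemma cgrade_direct v (S : seq deg) (c : deg -> coulomb k s t v) : uniq S ->
  (forall g, cgrade g (c g)) -> \sum_(g <- S) c g = 0 -> forall g, g \in S -> c g = 0.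
Proof.
move=> uS cH S0 g gS; apply: val_inj.
apply: (thomog_direct (x := fun g => val (c g)) uS cH _ gS).
by have := congr1 val S0; rewrite raddf_sum.
Qed.

Lemma FMO_cgrade v m d (f : tLam k E v) (mv : leqv m v) (fL : f \in Lam k E v m) :
  f \is d.-homog -> cgrade (zvec m, d%:Z + half_form s t (zvec m)) (FMO s t mv fL).
Proof. exact: fmo_thomog. Qed.

(** H is left general so that the lemma serves both for [cgrade] and for homogeneity of an element
    together with its image. *)
Lemma coulomb_spanned v (H : deg -> coulomb k s t v -> Prop) :
  (forall g, H g 0) -> (forall g x y, H g x -> H g y -> H g (x - y)) ->
  H 0 1 -> (forall g h x y, H g x -> H h y -> H (g + h) (x * y)) ->
  (forall m d f (mv : leqv m v) (fL : f \in Lam k E v m), f \is d.-homog ->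
    H (zvec m, d%:Z + half_form s t (zvec m)) (FMO s t mv fL)) ->
  forall a, spanned H a.
Proof.
move=> H0 HB H1 HM HF; apply: coulomb_ind => [m f mv fL||a b|a b].
(* The homogeneous components of an invariant f are invariant, and [fmo] is additive in f. *)
- pose F d := FMO s t mv (pihomog_Lam d fL).
  exists [seq ((zvec m, d%:Z + half_form s t (zvec m)), F d) | d <- iota 0 (msize f)].
    by move=> _ /mapP[d _ ->]; apply: HF; apply: pihomogP.
  rewrite big_map; apply: val_inj; rewrite [RHS]raddf_sum /=.
  rewrite {1}(pihomog_partitionE (leqnn (mmeasure mdeg f))) raddf_sum.
  by rewrite -(big_mkord predT (fun d => fmo s t m (pihomog mdeg d f))) /index_iota subn0.
- exact: spanned1.
- exact: spannedB.
- exact: spannedM.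
Qed.

Lemma cgrade_is_grading v : is_grading (@cgrade v).
Proof.
split; [exact: cgrade0 | exact: cgradeB | exact: cgrade1 | exact: cgradeM | | exact: cgrade_direct].
move=> a; have aS : spanned (@cgrade v) a.
  apply: coulomb_spanned; [exact: cgrade0 | exact: cgradeB | exact: cgrade1 | exact: cgradeM |].
  exact: FMO_cgrade.
by have [S [c [_ _ cH aE]]] := spanned_decomp (@cgrade0 v) (@cgradeB v) 0 aS; exists S, c.
Qed.

(** Every a is a sum of elements that are homogeneous together with their images. By directness, a
    homogeneous a of degree g equals its component c g, whose image has degree g. *)
Lemma respects_fmo_graded v v' (Phi : {rmorphism coulomb k s t v -> coulomb k s t v'}) :
  respects_fmo Phi -> forall g a, cgrade g a -> cgrade g (Phi a).
Proof.
move=> PhiF g a ga.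
pose H (h : deg) (x : coulomb k s t v) := cgrade h x /\ cgrade h (Phi x).
have H0 h : H h 0 by rewrite /H rmorph0; split; apply: cgrade0.
have HB h x y : H h x -> H h y -> H h (x - y).
  by move=> [hx Px] [hy Py]; split; rewrite ?rmorphB; apply: cgradeB.
have H1 : H 0 1 by rewrite /H rmorph1; split; apply: cgrade1.
have HM h h' x y : H h x -> H h' y -> H (h + h') (x * y).
  by move=> [hx Px] [hy Py]; split; rewrite ?rmorphM; apply: cgradeM.
have aS : spanned H a.
  apply: coulomb_spanned => // m d f mv fL fd; split; first exact: FMO_cgrade.
  rewrite /cgrade PhiF; case: ifP => mv'; last exact: thomog0.
  apply: fmo_thomog => //; apply: wsubst_homog fd => x.
  by case: insub => [r|]; [apply: w_homog | apply: dhomog0].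
have [S [c [uS gS cH aE]]] := spanned_decomp H0 HB g aS.
suff -> : a = c g by case: (cH g).
apply/eqP; rewrite eq_sym -subr_eq0; apply/eqP.
(* Subtracting a in degree g makes the components sum to 0, so [cgrade_direct] forces c g = a. *)
pose c' h := c h - (if h == g then a else 0).
have -> : c g - a = c' g by rewrite /c' eqxx.
apply: (cgrade_direct uS) => // [h|].
  apply: cgradeB; first by case: (cH h).
  by case: eqP => [->//|_]; apply: cgrade0.
rewrite sumrB -aE (bigD1_seq g) //= eqxx big1 ?addr0 ?subrr // => h /negPf->.
by [].
Qed.

End CoulombGrading.

Theorem theorem1p2 (k : comNzRingType) (I E : finType) (s t : E -> I) :
  exists gr : forall v : {ffun I -> nat},
      {ffun I -> int} * int -> coulomb k s t v -> Prop,
    (forall v : {ffun I -> nat},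
       is_grading (@gr v) /\
       (forall (m : {ffun I -> nat}) (f : tLam k E v) (d : nat)
          (mv : leqv m v) (fL : f \in Lam k E v m),
          f \is d.-homog ->
          gr v (zvec m, d%:Z + half_form s t (zvec m)) (FMO s t mv fL))) /\
    (forall v v' : {ffun I -> nat}, leqv v' v ->
       exists Phi : {rmorphism coulomb k s t v -> coulomb k s t v'},
         [/\ forall b, exists a, Phi a = b,
             forall g a, gr v g a -> gr v' g (Phi a)
           & forall (m : {ffun I -> nat}) (f : tLam k E v)
               (mv : leqv m v) (fL : f \in Lam k E v m),
               val (Phi (FMO s t mv fL)) =
               if leqv m v' then fmo s t m (restrict v' f) else 0]).
Proof.
exists (@cgrade k I E s t); split=> [v|v v' v'v].
  by split=> [|m f d mv fL]; [apply: cgrade_is_grading | apply: FMO_cgrade].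
have [Phi [PhiF PhiS]] := restriction_map k s t v'v; exists Phi; split=> //.
exact: respects_fmo_graded.
Qed.
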